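(* For $m,n,s,t=0,1,2,\dots$ and $\beta>-1$, $$\int_{\mathbb R^2}z_{m,n}^{(\beta)}(z,\bar z|q)\,\overline{z_{s,t}^{(\beta)}(z,\bar z|q)}\;r^{2\beta}\,d\mu(r^2|q)\,\frac{d\theta}{2\pi}=\zeta_{m\wedge n}(|m-n|+\beta)\,\delta_{m,s}\,\delta_{n,t},\qquad z=re^{i\theta},$$ where the pair $(d\mu(x|q),\zeta_n(\alpha))$ may be any of the following three: (i) $d\mu(x|q)=\dfrac{dx}{(-x;q)_\infty}$ on $(0,\infty)$, $\ \zeta_n(\alpha)=\Gamma(-\alpha)\Gamma(\alpha+1)\dfrac{(q^{-\alpha};q)_\infty}{(q;q)_\infty}\dfrac{(q^{\alpha+1};q)_n}{q^n(q;q)_n}$ (understood as a limit when $\alpha$ is a nonnegative integer); (ii) for $c>0$, $d\mu(x|q)=\displaystyle\sum_{k=-\infty}^\infty\frac{x\,\delta(x-cq^k)}{(-x;q)_\infty}$ (mass $cq^k/(-cq^k;q)_\infty$ at each point $cq^k$), $\ \zeta_n(\alpha)=\dfrac{(q,-cq^{\alpha+1},-q^{-\alpha}/c;q)_\infty\,c^{\alpha+1}}{(q^{\alpha+1},-c,-q/c;q)_\infty}\dfrac{(q^{\alpha+1};q)_n}{(q;q)_nq^n}$; (iii) for $c,\lambda>0$, $d\mu(x|q)=\dfrac{x^{-c}(-\lambda x,-\frac{q}{\lambda x};q)_\infty\,dx}{(-x,-\lambda q^cx,-\frac{q}{\lambda q^cx};q)_\infty}$ on $(0,\infty)$, $\ \zeta_n(\alpha)=\dfrac{(q^{\alpha+1};q)_n}{q^n(q;q)_n}\displaystyle\int_0^\infty\frac{x^{\alpha-c}(-\lambda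 x,-\frac q{\lambda x};q)_\infty\,dx}{(-x,-\lambda q^cx,-\frac q{\lambda q^cx};q)_\infty}$.
   Context: $0<q<1$; $(a;q)_n=\prod_{k=0}^{n-1}(1-aq^k)$, $(a;q)_\infty=\prod_{k\ge0}(1-aq^k)$, $(a_1,\dots,a_r;q)_n=\prod_i(a_i;q)_n$. For $\alpha>-1$ the $q$-Laguerre polynomials are $$L_n^{(\alpha)}(x;q)=(q^{\alpha+1};q)_n\sum_{k=0}^n\frac{q^{(\alpha+n-k)(n-k)}(-x)^{n-k}}{(q;q)_k(q,q^{\alpha+1};q)_{n-k}}.$$ For $\beta>-1$, $z^{(\beta)}_{m,n}(z_1,z_2|q)=z_1^{m-n}L_n^{(\beta+m-n)}(z_1z_2;q)$ if $m\ge n$, and $z^{(\beta)}_{m,n}(z_1,z_2|q)=z^{(\beta)}_{n,m}(z_2,z_1|q)$ if $m<n$. $m\wedge n=\min\{m,n\}$. The integral of $F(z)$ against $r^{2\beta}d\mu(r^2|q)\frac{d\theta}{2\pi}$ means $\int_0^\infty\frac1{2\pi}\int_0^{2\pi}F(\sqrt x\,e^{i\theta})\,d\theta\,x^\beta d\mu(x|q)$. *)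

(* Defs.v *)
From HB Require Import structures.
From mathcomp Require Import all_boot all_order all_algebra.
From mathcomp Require Import all_classical all_reals all_analysis.
From mathcomp Require Import measurable_realfun complex.

Set Implicit Arguments.
Unset Strict Implicit.
Unset Printing Implicit Defensive.

Import Order.TTheory GRing.Theory Num.Theory.
Import numFieldNormedType.Exports.

Local Open Scope classical_set_scope.
Local Open Scope ring_scope.
Local Open Scope complex_scope.

Section qPochhammer.
Context {R : realType}.
Implicit Types (a q : R) (s : seq R).

Definition qpoch a q (n : nat) : R := \prod_(k < n) (1 - a * q ^+ k).

Definition qpoch_inf a q : R := lim (qpoch a q n @[n --> \oo]).

(* [(a_1, ..., a_r; q)_n] and [(a_1, ..., a_r; q)_oo] *)
Definition qpochs s q (n : nat) : R := \prod_(a <- s) qpoch a q n.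

Definition qpochs_inf s q : R := \prod_(a <- s) qpoch_inf a q.

Lemma qpoch_ge1 a q n : 0 < q -> a <= 0 -> 1 <= qpoch a q n.
Proof.
move=> q0 a0; rewrite /qpoch; elim/big_ind : _ => // [x y x1 y1|k _].
  by rewrite -[leLHS]mulr1 ler_pM.
by rewrite lerDl -mulNr mulr_ge0 ?oppr_ge0// exprn_ge0// ltW.
Qed.

Lemma is_cvg_qpoch a q : 0 < q < 1 -> a <= 0 -> cvgn (qpoch a q).
Proof.
move=> /andP[q0 q1] a0; apply: nondecreasing_is_cvgn.
  apply/nondecreasing_seqP => n; rewrite /qpoch big_ord_recr/=.
  rewrite ler_peMr//; first exact: (le_trans ler01 (qpoch_ge1 n q0 a0)).
  by rewrite lerDl -mulNr mulr_ge0 ?oppr_ge0// exprn_ge0// ltW.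
exists (expR (- a * (1 - q)^-1)) => _ [n _ <-].
apply: (@le_trans _ _ (expR (series (geometric (- a) q) n))); last first.
  by rewrite ler_expR geometric_le_lim ?oppr_ge0// ger0_norm// ltW.
rewrite /series/= expR_sum big_mkord; apply: ler_prod => k _.
rewrite -mulNr expR_ge1Dx andbT addr_ge0// mulr_ge0 ?oppr_ge0//.
by rewrite exprn_ge0// ltW.
Qed.

Lemma qpoch_inf_ge1 a q : 0 < q < 1 -> a <= 0 -> 1 <= qpoch_inf a q.
Proof.
move=> q01 a0; apply: limr_ge; first exact: is_cvg_qpoch.
by apply: nearW => n; apply: qpoch_ge1 => //; case/andP: q01.
Qed.

Lemma qpoch_inf_ge0 a q : 0 < q < 1 -> a <= 0 -> 0 <= qpoch_inf a q.
Proof. by move=> q01 a0; rewrite (le_trans ler01)// qpoch_inf_ge1. Qed.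

Lemma measurable_qpoch_inf d (T : measurableType d) (D : set T) (f : T -> R) q :
  0 < q < 1 ->
  measurable D -> measurable_fun D f -> (forall x, D x -> f x <= 0) ->
  measurable_fun D (fun x => qpoch_inf (f x) q).
Proof.
move=> q01 mD mf f0.
apply: (@measurable_fun_cvg _ _ _ D (fun n x => qpoch (f x) q n)).
  move=> n; elim: n => [|n IHn].
    by under eq_fun do rewrite /qpoch big_ord0; exact: measurable_cst.
  under eq_fun do rewrite /qpoch big_ord_recr/=.
  apply: measurable_funM => //.
  by apply: measurable_funB => //; apply: measurable_funM.
by move=> x Dx; exact: is_cvg_qpoch (f0 _ Dx).
Qed.

End qPochhammer.

Section density_measure.
Context {R : realType}.
Variable w : R -> R.

(* the measure [w(x) dx] on [(0, +oo)] *)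
Definition density_measure (mw : measurable_fun (`]0, +oo[ : set R) w)
    (w0 : forall x, 0 < x -> 0 <= w x) : set (measurableTypeR R) -> \bar R :=
  fun U => (\int[lebesgue_measure]_(x in U `&` `]0%R, +oo[) (w x)%:E)%E.

Hypothesis mw : measurable_fun (`]0, +oo[ : set R) w.
Hypothesis w0 : forall x, 0 < x -> 0 <= w x.

Let density0 : density_measure mw w0 set0 = 0%E.
Proof. by rewrite /density_measure set0I integral_set0. Qed.

Let density_ge0 U : (0 <= density_measure mw w0 U)%E.
Proof.
apply: integral_ge0 => x [_ /=]; rewrite in_itv/= andbT => x0.
by rewrite lee_fin w0.
Qed.

Let density_sigma_additive : semi_sigma_additive (density_measure mw w0).
Proof.
move=> /= F mF tF mUF; rewrite /density_measure; apply: cvg_toP.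
  apply: ereal_nondecreasing_is_cvgn => m n mn.
  by apply: lee_sum_nneg_natr => // k _ _; exact: density_ge0.
rewrite setI_bigcupl ge0_integral_bigcup//=.
- by move=> k; apply: measurableI => //; exact: measurable_itv.
- apply/measurable_EFinP; apply: measurable_funS mw => //.
  by move=> x [k _ [_]].
- move=> x [k _ [_ /=]]; rewrite in_itv/= andbT => x0.
  by rewrite lee_fin w0.
- exact: trivIset_setIr.
Qed.

HB.instance Definition _ := isMeasure.Build _ _ _ (density_measure mw w0)
  density0 density_ge0 density_sigma_additive.

End density_measure.

Section Gamma.
Context {R : realType}.
Implicit Types x : R.

Definition Euler_integral x : R :=
  \int[lebesgue_measure]_(t in `]0, +oo[) (t `^ (x - 1) * expR (- t)).

(* Analytic continuation to the real [x] other than [0, -1, -2, ...] through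
   [Gamma x = Gamma (x + N) / (x (x + 1) ... (x + N - 1))], where [N] is the
   least natural number such that [0 < x + N]; so [N = 0] if [0 < x]. *)
Definition Gamma x : R :=
  let N := Num.truncn (1 - x) in
  Euler_integral (x + N%:R) / \prod_(k < N) (x + k%:R).

End Gamma.

Section polynomials.
Context {R : realType}.
Implicit Types (q alpha beta : R) (x z : R[i]).

Definition qLaguerre q alpha (n : nat) x : R[i] :=
  (qpoch (q `^ (alpha + 1)) q n)%:C *
  \sum_(k < n.+1)
    (q `^ ((alpha + (n - k)%:R) * (n - k)%:R) /
     (qpoch q q k * qpochs [:: q; q `^ (alpha + 1)] q (n - k)))%:C *
    (- x) ^+ (n - k).

Definition qLaguerre2_ge q beta (m n : nat) z1 z2 : R[i] :=
  z1 ^+ (m - n) * qLaguerre q (beta + (m - n)%:R) n (z1 * z2).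

Definition qLaguerre2 q beta (m n : nat) z1 z2 : R[i] :=
  if (n <= m)%N then qLaguerre2_ge q beta m n z1 z2
  else qLaguerre2_ge q beta n m z2 z1.

End polynomials.

Section complex_integral.
Context d (T : measurableType d) (R : realType).
Variables (mu : {measure set T -> \bar R}) (D : set T) (f : T -> R[i]).

Definition cintegrable : Prop :=
  mu.-integrable D (fun x => (complex.Re (f x))%:E) /\
  mu.-integrable D (fun x => (complex.Im (f x))%:E).

Definition cintegral : R[i] :=
  (\int[mu]_(x in D) complex.Re (f x)) +i* (\int[mu]_(x in D) complex.Im (f x)).

End complex_integral.

Section polar_integral.
Context {R : realType}.
Variables (mu : {measure set (measurableTypeR R) -> \bar R}) (beta : R) (F : R[i] -> R[i]).

(* [F (sqrt x * e^(i theta))] *)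
Definition polar_fun (x theta : R) : R[i] :=
  F ((Num.sqrt x)%:C * (cos theta +i* sin theta)).

Definition angular_mean (x : R) : R[i] :=
  ((2 * pi)^-1)%:C * cintegral lebesgue_measure `[0, 2 * pi] (polar_fun x).

(* the integral of [F z] against [r^(2 beta) dmu(r^2) dtheta / (2 pi)] *)
Definition polar_integral : R[i] :=
  cintegral mu `]0, +oo[ (fun x => angular_mean x * (x `^ beta)%:C).

(* needed because [Rintegral] is a total function: [polar_integral] is a genuine
   iterated Lebesgue integral only under this condition *)
Definition polar_integrable : Prop :=
  (forall x, 0 < x -> cintegrable lebesgue_measure `[0, 2 * pi] (polar_fun x)) /\
  cintegrable mu `]0, +oo[ (fun x => angular_mean x * (x `^ beta)%:C).

End polar_integral.

Lemma measurable_fun_invr_ge0 {R : realType} d (T : measurableType d)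
    (D : set T) (f : T -> R) :
  measurable_fun D f -> (forall x, D x -> 0 <= f x) ->
  measurable_fun D (fun x => (f x)^-1).
Proof.
move=> mf f0; apply: (eq_measurable_fun (fun x => f x `^ (-1))).
  by move=> x /set_mem Dx; rewrite powR_inv1// f0.
exact: (measurableT_comp (measurable_powR (-1)) mf).
Qed.

Section lebesgue_weight.
Context {R : realType}.
Variable q : R.
Hypothesis q01 : 0 < q < 1.

Definition weight1 (x : R) : R := (qpoch_inf (- x) q)^-1.

Lemma weight1_ge0 x : 0 < x -> 0 <= weight1 x.
Proof. by move=> x0; rewrite invr_ge0 qpoch_inf_ge0// oppr_le0 ltW. Qed.

Lemma measurable_weight1 : measurable_fun (`]0, +oo[ : set R) weight1.
Proof.
have x0 (x : R) : `]0, +oo[%classic x -> - x <= 0.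
  by rewrite /= in_itv/= andbT => /ltW; rewrite oppr_le0.
apply: measurable_fun_invr_ge0.
  by apply: measurable_qpoch_inf => //; exact: measurableT_comp.
by move=> x /x0 ?; exact: qpoch_inf_ge0.
Qed.

Definition mu1 : {measure set (measurableTypeR R) -> \bar R} :=
  density_measure measurable_weight1 weight1_ge0.

Definition zeta1_formula (n : nat) (alpha : R) : R :=
  Gamma (- alpha) * Gamma (alpha + 1) *
  (qpoch_inf (q `^ (- alpha)) q / qpoch_inf q q) *
  (qpoch (q `^ (alpha + 1)) q n / (q ^+ n * qpoch q q n)).

Definition zeta1 (n : nat) (alpha : R) : R :=
  if alpha \is a Num.nat then lim (zeta1_formula n a @[a --> alpha^'])
  else zeta1_formula n alpha.

End lebesgue_weight.

Section discrete_weight.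
Context {R : realType}.
Variables q c : R.
Hypotheses (q01 : 0 < q < 1) (c0 : 0 < c).

Definition mass2 (k : int) : R := c * q ^ k / qpoch_inf (- (c * q ^ k)) q.

Lemma mass2_ge0 k : 0 <= mass2 k.
Proof.
have qk : 0 <= c * q ^ k.
  by rewrite mulr_ge0 ?(ltW c0)// exprz_ge0//; case/andP: q01 => /ltW.
by rewrite divr_ge0// qpoch_inf_ge0// oppr_le0.
Qed.

Definition atom2 (k : int) : {measure set (measurableTypeR R) -> \bar R} :=
  mscale (NngNum (mass2_ge0 k)) (dirac (c * q ^ k : measurableTypeR R)).

(* the sum of [atom2 k] over all integers [k], [Negz n] being [- n.+1] *)
Definition mu2 : {measure set (measurableTypeR R) -> \bar R} :=
  measure_add (mseries (fun n => atom2 (Posz n)) 0)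
              (mseries (fun n => atom2 (Negz n)) 0).

Definition zeta2 (n : nat) (alpha : R) : R :=
  qpochs_inf [:: q; - (c * q `^ (alpha + 1)); - (q `^ (- alpha) / c)] q *
    c `^ (alpha + 1) /
    qpochs_inf [:: q `^ (alpha + 1); - c; - (q / c)] q *
  (qpoch (q `^ (alpha + 1)) q n / (qpoch q q n * q ^+ n)).

End discrete_weight.

Section theta_weight.
Context {R : realType}.
Variables q c lambda : R.
Hypotheses (q01 : 0 < q < 1) (c0 : 0 < c) (lambda0 : 0 < lambda).

(* the density for [e = - c], the integrand of [zeta3] for [e = alpha - c] *)
Definition theta_quotient (e x : R) : R :=
  x `^ e * qpochs_inf [:: - (lambda * x); - (q / (lambda * x))] q /
  qpochs_inf [:: - x; - (lambda * q `^ c * x); - (q / (lambda * q `^ c * x))] q.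

Definition weight3 (x : R) : R := theta_quotient (- c) x.

Let q0 : 0 < q. Proof. by case/andP: q01. Qed.

Let lambdaq0 : 0 < lambda * q `^ c.
Proof. by rewrite mulr_gt0// powR_gt0. Qed.

Let arg_le0 (a x : R) : 0 < a -> 0 < x -> - (a * x) <= 0 /\ - (q / (a * x)) <= 0.
Proof.
move=> a0 x0; rewrite !oppr_le0; split; first exact/ltW/mulr_gt0.
by apply/ltW/divr_gt0 => //; exact: mulr_gt0.
Qed.

Lemma weight3_ge0 x : 0 < x -> 0 <= weight3 x.
Proof.
move=> x0; rewrite /weight3 /theta_quotient /qpochs_inf !big_cons !big_nil !mulr1.
have [? ?] := arg_le0 lambda0 x0; have [? ?] := arg_le0 lambdaq0 x0.
have ? : - x <= 0 by rewrite oppr_le0 ltW.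
by rewrite divr_ge0 ?mulr_ge0 ?powR_ge0 ?qpoch_inf_ge0.
Qed.

Lemma measurable_weight3 : measurable_fun (`]0, +oo[ : set R) weight3.
Proof.
have pos (x : R) : `]0, +oo[%classic x -> 0 < x by rewrite /= in_itv/= andbT.
have mlin (a : R) : measurable_fun (`]0, +oo[ : set R) (fun x : R => a * x).
  exact: measurable_funM.
have mp (a : R) : 0 < a ->
    measurable_fun (`]0, +oo[ : set R) (fun x => qpoch_inf (- (a * x)) q).
  move=> a0; apply: measurable_qpoch_inf => //; first exact: measurableT_comp.
  by move=> x /pos /(arg_le0 a0)[].
have mi (a : R) : 0 < a ->
    measurable_fun (`]0, +oo[ : set R) (fun x => qpoch_inf (- (q / (a * x))) q).
  move=> a0; apply: measurable_qpoch_inf => //; last first.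
    by move=> x /pos /(arg_le0 a0)[].
  apply: measurableT_comp => //; apply: measurable_funM => //.
  apply: measurable_fun_invr_ge0 => // x /pos x0.
  by rewrite ltW// mulr_gt0.
rewrite (_ : weight3 = fun x => x `^ (- c) *
    (qpoch_inf (- (lambda * x)) q * qpoch_inf (- (q / (lambda * x))) q) *
    (qpoch_inf (- x) q * (qpoch_inf (- (lambda * q `^ c * x)) q *
      qpoch_inf (- (q / (lambda * q `^ c * x))) q))^-1); last first.
  apply/funext => x; rewrite /weight3 /theta_quotient /qpochs_inf.
  by rewrite !big_cons !big_nil !mulr1.
apply: measurable_funM.
  apply: measurable_funM; first exact: measurable_funTS (measurable_powR _).
  by apply: measurable_funM; [exact: mp|exact: mi].
apply: measurable_fun_invr_ge0; last first.
  move=> x /pos x0; have [? ?] := arg_le0 lambdaq0 x0.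
  have ? : - x <= 0 by rewrite oppr_le0 ltW.
  by rewrite !mulr_ge0 ?qpoch_inf_ge0.
apply: measurable_funM; last by apply: measurable_funM; [exact: mp|exact: mi].
apply: measurable_qpoch_inf => //.
by move=> x /pos; rewrite oppr_le0 => /ltW.
Qed.

Definition mu3 : {measure set (measurableTypeR R) -> \bar R} :=
  density_measure measurable_weight3 weight3_ge0.

Definition zeta3 (n : nat) (alpha : R) : R :=
  qpoch (q `^ (alpha + 1)) q n / (q ^+ n * qpoch q q n) *
  \int[lebesgue_measure]_(x in `]0, +oo[) theta_quotient (alpha - c) x.

End theta_weight.

Inductive qLaguerre_pair {R : realType} (q : R) (q01 : 0 < q < 1) :
    {measure set (measurableTypeR R) -> \bar R} -> (nat -> R -> R) -> Prop :=
| qLaguerre_pair1 :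
    qLaguerre_pair q01 (mu1 q01) (zeta1 q)
| qLaguerre_pair2 (c : R) (c0 : 0 < c) :
    qLaguerre_pair q01 (mu2 q01 c0) (zeta2 q c)
| qLaguerre_pair3 (c lambda : R) (c0 : 0 < c) (lambda0 : 0 < lambda) :
    qLaguerre_pair q01 (mu3 c q01 lambda0) (zeta3 q c lambda).

(* Main.v *)
Require Import Defs.
From HB Require Import structures.
From mathcomp Require Import all_boot all_order all_algebra.
From mathcomp Require Import all_classical all_reals all_analysis.
From mathcomp Require Import measurable_realfun complex.
From mathcomp Require Import ring lra zify.

Set Implicit Arguments.
Unset Strict Implicit.
Unset Printing Implicit Defensive.

Import Order.TTheory GRing.Theory Num.Theory.
Import numFieldNormedType.Exports.

Local Open Scope classical_set_scope.
Local Open Scope ring_scope.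
Local Open Scope complex_scope.

(** For each of the three measures let [M s] be the integral of [x^s] over the
    half-line, for [s > -1].  The theorem holds because

    - [M s] is finite and [M (s+1) = (q^(-s-1) - 1) M s], and
    - [M alpha] is the factor of [zeta n alpha] that does not depend on [n].

    Given the recurrence, the rest is the same for every measure
    ([polar_qLaguerre]).  In polar coordinates the product
    [z_{m,n} conj(z_{s,t})] is a function of [x = r^2] times a power of
    [e^(i theta)]; its mean over the circle vanishes unless [m - n = s - t]
    ([cintegral_cis]), and then what remains is the integral of
    [x^alpha L_N(x) L_N'(x)] with [alpha = beta + |m - n|], [N = min(m, n)] and
    [N' = min(s, t)].  The recurrence gives the moments in closed form,
    [M (alpha + k) / M alpha = (a; q)_k a^(-k) q^(-k(k-1)/2)] with
    [a = q^(alpha + 1)], so that integrating [L_N(x) x^k] becomes an alternating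
    sum over the values at [1, q^(-1), ..., q^(-N)] of a polynomial of degree
    [k].  By the finite q-binomial theorem that sum is an [N]-th q-difference,
    which kills all degrees below [N] ([q_difference], [qLaguerre_orthogonal]).

    The recurrence for a density [w] is the substitution of [q x] for [x],
    provided that [w (q x) = (1 + x) w x] ([density_moment_rec]).  The weight
    [1/(-x; q)_oo] has this property because [(-q x; q)_oo] is [(-x; q)_oo]
    without its first factor; the third weight is this one times a function
    invariant under [x -> q x], a power of [x] times a quotient of two theta
    products ([theta_ratio_scale]).  That function
    is bounded, being bounded on [[q, 1]], so finiteness carries over.  For the
    third measure [M alpha] is by definition the integral occurring in
    [zeta n alpha].

    For the first measure [M] has to be computed (Ramanujan's q-beta integral,
    [moment1E]).  If [-1 < alpha < 0], the integrals of
    [x^alpha / (-x; q)_n] satisfy a first order recurrence in [n] which starts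
    from the beta integral [Gamma(-alpha) Gamma(alpha + 1)], and [n] goes to
    infinity ([weight1_moment]).  The recurrence in [alpha] extends the formula
    to all [alpha > -1] that are not natural numbers, and continuity of [M]
    gives the limit that defines [zeta] at the natural numbers ([zeta1E]).

    For the second measure [M] is a bilateral series in [c q^k]
    ([ramanujan_sum]), the case [b = 0] of Ramanujan's 1-psi-1 sum.  Damping the
    terms [k >= -N] by [(q^(N+k+1); q)_oo] turns it into a unilateral series,
    summed by the q-binomial theorem; the damping disappears as [N] grows
    ([cvg_lattice_sum]).  The recurrence is then read off the closed form. *)

(** * Finite q-calculus *)

Section finite_qcalculus.
Context {R : realType}.
Implicit Types (a q z : R).

Lemma powR_01 q s : 0 < q < 1 -> 0 < s -> 0 < q `^ s < 1.
Proof.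
move=> /andP[q0 q1] s0; rewrite powR_gt0//=.
have := gt0_ltr_powR s0 _ _ q1; rewrite powR1; apply; rewrite nnegrE//.
exact: ltW.
Qed.

Lemma qpoch0 a q : qpoch a q 0 = 1.
Proof. by rewrite /qpoch big_ord0. Qed.

Lemma qpochSr a q n : qpoch a q n.+1 = qpoch a q n * (1 - a * q ^+ n).
Proof. by rewrite /qpoch big_ord_recr. Qed.

Lemma qpochSl a q n : qpoch a q n.+1 = (1 - a) * qpoch (a * q) q n.
Proof.
rewrite /qpoch big_ord_recl expr0 mulr1; congr (_ * _).
by apply: eq_bigr => i _; rewrite /= /bump/= exprS mulrA.
Qed.

Lemma qpochD a q m n : qpoch a q (m + n) = qpoch a q m * qpoch (a * q ^+ m) q n.
Proof.
elim: m a => [|m IHm] a; first by rewrite qpoch0 mul1r expr0 mulr1.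
by rewrite addSn !qpochSl IHm exprS !mulrA.
Qed.

Lemma qpoch_gt0 a q n : 0 < q < 1 -> a < 1 -> 0 < qpoch a q n.
Proof.
move=> /andP[q0 q1] a1; apply: prodr_gt0 => k _; rewrite subr_gt0.
have [a0|a0] := leP a 0; last first.
  by rewrite (le_lt_trans _ a1)// ler_piMr ?exprn_ile1 ?ltW.
by rewrite (le_lt_trans _ ltr01)// mulr_le0_ge0// exprn_ge0 ?ltW.
Qed.

Lemma qpoch_neq0 a q n : 0 < q < 1 -> a < 1 -> qpoch a q n != 0.
Proof. by move=> q01 a1; rewrite gt_eqF// qpoch_gt0. Qed.

Lemma qpoch_qV_eq0 q i n : q != 0 -> (i < n)%N -> qpoch (q ^- i) q n = 0.
Proof.
move=> q0 lt_in; rewrite /qpoch (bigD1 (Ordinal lt_in))//=.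
by rewrite mulVf ?expf_neq0// subrr mul0r.
Qed.

(** The factors [1 / ((q; q)_(n-j) (q; q)_j)] are Gaussian binomials divided by
    [(q; q)_n]; in this form q-Pascal's rule gives the induction step. *)
Lemma finite_q_binomial q z n : 0 < q < 1 ->
  \sum_(j < n.+1) (- z) ^+ j * q ^+ 'C(j, 2) / (qpoch q q (n - j) * qpoch q q j)
  = qpoch z q n / qpoch q q n.
Proof.
move=> q01; have [q0 q1] := andP q01.
have Qn k : qpoch q q k != 0 by exact: qpoch_neq0.
elim: n => [|n IHn].
  by rewrite big_ord1 /= !qpoch0 !mul1r.
have qn : 1 - q ^+ n.+1 != 0.
  by rewrite subr_eq0 gt_eqF// exprn_ilt1 ?ltW.
apply: (mulfI qn).
transitivity ((1 - z * q ^+ n) * (qpoch z q n / qpoch q q n)); last first.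
  by rewrite !qpochSr -exprS; field; rewrite Qn qn.
rewrite -{}IHn mulr_sumr.
pose T j := (- z) ^+ j * q ^+ 'C(j, 2) / (qpoch q q (n - j) * qpoch q q j).
(* q-Pascal: [1 - q^(n+1)] splits as [(1 - q^(n+1-j)) + q^(n+1-j) (1 - q^j)] *)
pose A j := if (j <= n)%N then T j else 0.
pose B j := if j is j'.+1 then z * q ^+ n * T j' else 0.
rewrite (eq_bigr (fun j : 'I_n.+2 => A j - B j)); last first.
  move=> [j /=]; rewrite ltnS => jn _; rewrite /A /B /T.
  case: j jn => [_|j jn].
    rewrite subn0 leq0n subr0 subn0 qpochSr -exprS; field.
    by rewrite !Qn qn.
  case: ltnP => [{}jn|nj].
    have -> : (n.+1 - j.+1 = (n - j.+1).+1)%N by lia.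
    have -> : (n - j = (n - j.+1).+1)%N by lia.
    rewrite !qpochSr -!exprS.
    have h k : 1 - q ^+ k.+1 != 0 by rewrite subr_eq0 gt_eqF// exprn_ilt1 ?ltW.
    have -> : 'C(j.+1, 2) = ('C(j, 2) + j)%N by rewrite binS bin1 addnC.
    have e : q ^+ n.+1 = q * (q ^+ (n - j.+1).+1 * q ^+ j).
      by rewrite -exprD -exprS; congr (_ ^+ _); lia.
    have e' : q ^+ n = q ^+ (n - j.+1).+1 * q ^+ j.
      by rewrite -exprD; congr (_ ^+ _); lia.
    rewrite e e' exprD (exprS (- z)) [q ^+ j.+1]exprS.
    have := h j; have := h (n - j.+1)%N; rewrite [q ^+ j.+1]exprS => h1 h2.
    by field; rewrite !Qn h1 h2.
  have -> : j = n by lia.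
  rewrite !subnn qpoch0 !qpochSr -!exprS.
  have -> : 'C(n.+1, 2) = ('C(n, 2) + n)%N by rewrite binS bin1 addnC.
  by rewrite exprD (exprS (- z)); field; rewrite ?Qn ?oner_neq0 qn.
rewrite sumrB big_ord_recr/= {2}/A ltnn addr0.
rewrite [X in _ - X]big_ord_recl/= add0r mulrBl mul1r; congr (_ - _).
  by apply: eq_bigr => -[i /= i_n] _; rewrite /A -ltnS i_n.
by rewrite mulr_sumr; apply: eq_bigr => i _.
Qed.

End finite_qcalculus.

(** * Orthogonality with respect to a moment sequence *)

Section moment_functional.
Context {R : realType}.
Implicit Types (a q z : R) (p : {poly R}).

Lemma bin2D j k : 'C(j + k, 2) = ('C(j, 2) + 'C(k, 2) + j * k)%N.
Proof.
elim: k => [|k IHk]; first by rewrite addn0 muln0 !addn0.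
by rewrite addnS !binS !bin1 IHk mulnS; lia.
Qed.

Lemma qpoch_qV q n : q != 0 ->
  qpoch (q ^- n) q n = (-1) ^+ n * q ^- 'C(n.+1, 2) * qpoch q q n.
Proof.
move=> q0; rewrite /qpoch (reindex_inj rev_ord_inj)/=.
rewrite (eq_bigr (fun i : 'I_n => - q ^- i.+1 * (1 - q * q ^+ i))); last first.
  move=> i _; have -> : q ^- n = q ^- i.+1 * q ^- (n - i.+1).
    by rewrite -invfM -exprD subnKC.
  have h k : q ^+ k != 0 by rewrite expf_neq0.
  by rewrite divfK// -exprS mulrBr mulr1 mulNr mulVf// opprK addrC.
rewrite big_split/=; congr (_ * _).
elim: n => [|n IHn]; first by rewrite big_ord0 invr1 mulr1.
rewrite big_ord_recr/= IHn [in RHS]binS bin1 exprD invfM.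
by rewrite [(-1) ^+ n.+1]exprSr; field; rewrite ?expf_neq0.
Qed.

(** The finite q-binomial theorem turns this alternating sum into an [n]-th
    q-difference: it annihilates [q^(-ij)] for [i < n] because then
    [(q^(-i); q)_n = 0]. *)
Lemma q_difference q p n : 0 < q < 1 -> (size p <= n.+1)%N ->
  \sum_(j < n.+1) (-1) ^+ j * q ^+ 'C(j, 2) * p.[q ^- j] /
    (qpoch q q (n - j) * qpoch q q j)
  = p`_n * ((-1) ^+ n * q ^- 'C(n.+1, 2)).
Proof.
move=> q01 sp; have [q_gt0 _] := andP q01; have q0 : q != 0 by rewrite gt_eqF.
transitivity (\sum_(i < n.+1) p`_i * (qpoch (q ^- i) q n / qpoch q q n)).
  under eq_bigr => j _.
    rewrite (horner_coef_wide _ sp) mulr_sumr mulr_suml; over.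
  rewrite exchange_big/=; apply: eq_bigr => i _.
  rewrite -finite_q_binomial// mulr_sumr; apply: eq_bigr => j _.
  rewrite [in RHS]exprNn -!exprVn exprAC.
  by rewrite !mulrA; congr (_ / _); ring.
rewrite big_ord_recr/= big1 ?add0r => [|i _].
  by rewrite qpoch_qV// mulfK// qpoch_neq0//; case/andP: q01.
by rewrite qpoch_qV_eq0// mul0r mulr0.
Qed.

Variables (q a : R) (mom : nat -> R).
Hypotheses (q01 : 0 < q < 1) (a01 : 0 < a < 1).
Hypothesis momS : forall k, mom k.+1 = ((a * q ^+ k)^-1 - 1) * mom k.

Let q0 : q != 0. Proof. by case/andP: q01 => q0 _; rewrite gt_eqF. Qed.
Let a0 : a != 0. Proof. by case/andP: a01 => a0 _; rewrite gt_eqF. Qed.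
Let Q n : qpoch q q n != 0.
Proof. by rewrite qpoch_neq0//; case/andP: q01. Qed.
Let A n : qpoch a q n != 0.
Proof. by rewrite qpoch_neq0//; case/andP: a01. Qed.

Lemma momE k : mom k = qpoch a q k / (a ^+ k * q ^+ 'C(k, 2)) * mom 0.
Proof.
elim: k => [|k IHk]; first by rewrite qpoch0 !mul1r invr1 mul1r.
rewrite momS IHk qpochSr binS bin1 exprD exprS; field.
by rewrite ?expf_neq0 ?a0.
Qed.

(** The coefficient of [x^j] in the q-Laguerre polynomial of degree [n] with
    [a = q^(alpha + 1)]. *)
Definition qLaguerre_coef n j : R :=
  qpoch a q n * ((-1) ^+ j * a ^+ j * q ^+ ('C(j, 2) + 'C(j, 2))) /
  (qpoch q q (n - j) * qpoch q q j * qpoch a q j).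

(** With the moments inserted, [(a; q)_(j+k) / (a; q)_j = (a q^j; q)_k] makes the
    [j]-th term the value at [q^(-j)] of [prod_(i < k) (X - a q^i)], so that
    the sum is a q-difference of a monic polynomial of degree [k]. *)
Lemma qLaguerre_moment n k : (k <= n)%N ->
  \sum_(j < n.+1) qLaguerre_coef n j * mom (j + k) =
  (k == n)%:R * (mom 0 * qpoch a q n * (-1) ^+ n / (a ^+ n * q ^+ (n * n))).
Proof.
move=> kn.
pose p : {poly R} := \prod_(i <- [seq a * q ^+ i | i <- iota 0 k]) ('X - i%:P).
have sp : size p = k.+1 by rewrite size_prod_XsubC size_map size_iota.
have pE j : p.[q ^- j] = qpoch (a * q ^+ j) q k / q ^+ (j * k).
  rewrite /p horner_prod big_map (_ : iota 0 k = index_iota 0 k) ?subn0 ?big_mkord; last first.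
    by rewrite /index_iota subn0.
  rewrite /qpoch.
  have h : q ^+ (j * k) != 0 by rewrite expf_neq0.
  apply: (canRL (mulfK h)); rewrite {h}.
  elim: k {kn p sp} => [|k IHk]; first by rewrite !big_ord0 mul1r muln0.
  rewrite !big_ord_recr/= -IHk mulnS exprD hornerXsubC; field.
  by rewrite expf_neq0.
rewrite (eq_bigr (fun j : 'I_n.+1 =>
    mom 0 * qpoch a q n / (a ^+ k * q ^+ 'C(k, 2)) *
    ((-1) ^+ j * q ^+ 'C(j, 2) * p.[q ^- j] /
    (qpoch q q (n - j) * qpoch q q j)))); last first.
  move=> j _; rewrite momE pE /qLaguerre_coef bin2D qpochD !exprD; field.
  by rewrite ?Q ?A ?expf_neq0.
rewrite -mulr_sumr q_difference ?sp//.
have [kn'|kn'] := eqVneq k n; last first.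
  by rewrite nth_default ?sp 1?ltn_neqAle ?kn' // !mul0r mulr0.
have -> : p`_n = 1.
  have := monic_prod_XsubC [seq a * q ^+ i | i <- iota 0 k] xpredT id.
  by rewrite -/p monicE /lead_coef sp /= kn' => /eqP.
rewrite !mul1r kn'.
have -> : (n * n = 'C(n, 2) + 'C(n.+1, 2))%N.
  by rewrite binS bin1; elim: (n) => // m IH; rewrite binS bin1; lia.
by rewrite exprD; field; rewrite ?expf_neq0 ?a0.
Qed.

(** If [m <= n], only the coefficient of [x^n] in the polynomial of degree [m]
    pairs nontrivially with the one of degree [n]. *)
Lemma qLaguerre_orthogonal m n :
  \sum_(j < n.+1) \sum_(k < m.+1)
    qLaguerre_coef n j * qLaguerre_coef m k * mom (j + k) =
  (m == n)%:R * (mom 0 * (qpoch a q n / (q ^+ n * qpoch q q n))).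
Proof.
wlog le_mn : m n / (m <= n)%N => [hw|].
  have [/hw//|/ltnW nm] := leqP m n.
  rewrite exchange_big/= eq_sym.
  under eq_bigr => i _ do under eq_bigr => j _ do
    rewrite addnC [qLaguerre_coef n j * _]mulrC.
  by rewrite hw//; case: eqP => [->//|]; rewrite !mul0r.
rewrite exchange_big/=.
under eq_bigr => k _.
  under eq_bigr do rewrite [_ n _ * _]mulrC -mulrA.
  rewrite -mulr_sumr qLaguerre_moment; last by rewrite (leq_trans _ le_mn)// -ltnS.
  over.
rewrite big_ord_recr/= big1 ?add0r => [|k _]; last first.
  by rewrite ltn_eqF ?(leq_trans _ le_mn)// mul0r mulr0.
have [->|] := eqVneq m n; last by rewrite !mul0r mulr0.
rewrite !mul1r /qLaguerre_coef subnn qpoch0.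
have -> : (n * n = 'C(n, 2) + 'C(n, 2) + n)%N.
  by elim: (n) => // k IH; rewrite binS bin1; lia.
rewrite !exprD; have /eqP := sqrr_sign R n; rewrite expr2 => /eqP h.
apply/eqP; rewrite -subr_eq0; apply/eqP.
transitivity ((mom 0 * qpoch a q n / (q ^+ n * qpoch q q n)) *
  ((-1) ^+ n * (-1) ^+ n - 1)); last by rewrite h subrr mulr0.
by field; rewrite ?Q ?A ?oner_neq0 ?expf_neq0.
Qed.

End moment_functional.

(** * Angular means *)

Section fourier.
Context {R : realType}.
Implicit Types (k x theta : R) (A B n : nat).
Local Notation leb := (@lebesgue_measure R).

Lemma sin_2pi_sub A B : sin ((A%:R - B%:R) * (2 * pi)) = 0 :> R.
Proof.
have e n : n%:R * (2 * pi) = 0 + (pi *+ 2) *+ n :> R by rewrite add0r; ring.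
rewrite mulrBl sinB !e.
rewrite (periodicn (@sinD2pi R)) (periodicn (@cosD2pi R)).
by rewrite (periodicn (@sinD2pi R)) (periodicn (@cosD2pi R)) !sin0; ring.
Qed.

Lemma cos_2pi_sub A B : cos ((A%:R - B%:R) * (2 * pi)) = 1 :> R.
Proof.
have e n : n%:R * (2 * pi) = 0 + (pi *+ 2) *+ n :> R by rewrite add0r; ring.
rewrite mulrBl cosB !e.
rewrite (periodicn (@sinD2pi R)) (periodicn (@cosD2pi R)).
by rewrite (periodicn (@sinD2pi R)) (periodicn (@cosD2pi R)) !sin0 cos0; ring.
Qed.

Lemma expr_cis theta n :
  (cos theta +i* sin theta) ^+ n = cos (n%:R * theta) +i* sin (n%:R * theta).
Proof.
elim: n => [|n IHn]; first by rewrite !mul0r cos0 sin0.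
rewrite exprS IHn -natr1 [(_ + 1) * theta]mulrDl mul1r cosD sinD.
by apply/eqP; rewrite eq_complex/=; apply/andP; split; apply/eqP; ring.
Qed.

Lemma cis_mul_conj theta A B :
  (cos theta +i* sin theta) ^+ A * conjc (cos theta +i* sin theta) ^+ B =
  cos ((A%:R - B%:R) * theta) +i* sin ((A%:R - B%:R) * theta).
Proof.
rewrite -rmorphXn/= !expr_cis/= mulrBl cosB sinB.
by apply/eqP; rewrite eq_complex/=; apply/andP; split; apply/eqP; ring.
Qed.

Lemma FTC2_is_derive (f F : R -> R) (a b : R) : a < b -> continuous f ->
  (forall x, is_derive x 1 F (f x)) ->
  leb.-integrable `[a, b] (EFin \o f) /\
  \int[leb]_(x in `[a, b]) f x = F b - F a.
Proof.
move=> ab cf dF; have cF : continuous F.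
  move=> x; apply/differentiable_continuous/derivable1_diffP.
  exact: (@ex_derive _ _ _ _ _ _ _ (dF x)).
split.
  apply: continuous_compact_integrable; first exact: segment_compact.
  exact: continuous_subspaceT.
rewrite /Rintegral (continuous_FTC2 (F := F))//=.
- exact: continuous_subspaceT.
- split=> [x _||].
  + exact: (@ex_derive _ _ _ _ _ _ _ (dF x)).
  + by apply: cvg_at_right_filter; exact: cF.
  + by apply: cvg_at_left_filter; exact: cF.
- by move=> x _; rewrite derive1E (@derive_val _ _ _ _ _ _ _ (dF x)).
Qed.

Lemma is_derive_scale (k x : R) : is_derive x 1 ( *%R k) k.
Proof.
have := @is_deriveZ _ _ _ _ k x 1 _ (is_derive_id x (1 : R)).
by rewrite /GRing.scale/= mulr1.
Qed.

Lemma continuous_scale k : continuous ( *%R k : R -> R).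
Proof. by move=> x; exact: mulrl_continuous. Qed.

Lemma integral_cos_2pi A B :
  leb.-integrable `[0, 2 * pi] (fun t => (cos ((A%:R - B%:R) * t))%:E) /\
  \int[leb]_(t in `[0, 2 * pi]) cos ((A%:R - B%:R) * t) = (A == B)%:R * (2 * pi).
Proof.
have pi2 : 0 < 2 * pi :> R by rewrite mulr_gt0// pi_gt0.
have [->|AB] := eqVneq A B.
  rewrite subrr.
  have [i1 e] := @FTC2_is_derive (fun=> 1) id _ _ pi2 (@cst_continuous _ _ _)
     (fun x => is_derive_id x (1 : R)).
  split.
    apply: (eq_integrable _ _ _ _ i1) => // t _.
    by rewrite /= mul0r cos0.
  rewrite mul1r -[RHS]subr0 -e; apply: eq_Rintegral => t _.
  by rewrite mul0r cos0.
set k := _ - _; have k0 : k != 0 by rewrite subr_eq0 eqr_nat.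
have [|x|? ->] := @FTC2_is_derive (fun t => cos (k * t))
    (fun t => k^-1 * sin (k * t)) _ _ pi2.
- by move=> x; apply: continuous_comp; [exact: continuous_scale|exact: continuous_cos].
- have := @is_deriveZ _ _ _ _ k^-1 x 1 _
    (is_derive1_comp (is_derive_sin (k * x)) (is_derive_scale k x)).
  by move/is_derive_eq; apply; rewrite /GRing.scale/=; field.
- by split => //; rewrite sin_2pi_sub !mulr0 sin0 mulr0 subrr mul0r.
Qed.

Lemma integral_sin_2pi A B :
  leb.-integrable `[0, 2 * pi] (fun t => (sin ((A%:R - B%:R) * t))%:E) /\
  \int[leb]_(t in `[0, 2 * pi]) sin ((A%:R - B%:R) * t) = 0.
Proof.
have pi2 : 0 < 2 * pi :> R by rewrite mulr_gt0// pi_gt0.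
have [->|AB] := eqVneq A B.
  rewrite subrr; split.
    apply: (eq_integrable _ _ _ _ (@integrable0 _ _ _ leb _)) => // t _.
    by rewrite mul0r sin0.
  transitivity (\int[leb]_(t in `[0, 2 * pi]) (0 : R)).
    by apply: eq_Rintegral => t _; rewrite mul0r sin0.
  by rewrite /Rintegral integral0.
set k := _ - _; have k0 : k != 0 by rewrite subr_eq0 eqr_nat.
have [|x|? ->] := @FTC2_is_derive (fun t => sin (k * t))
    (fun t => - k^-1 * cos (k * t)) _ _ pi2.
- by move=> x; apply: continuous_comp; [exact: continuous_scale|exact: continuous_sin].
- have := @is_deriveZ _ _ _ _ (- k^-1) x 1 _
    (is_derive1_comp (is_derive_cos (k * x)) (is_derive_scale k x)).
  by move/is_derive_eq; apply; rewrite /GRing.scale/=; field.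
- by split => //; rewrite cos_2pi_sub !mulr0 cos0 subrr.
Qed.

(** The mean over a circle only keeps the part of frequency zero. *)
Lemma cintegral_cis (C : R) A B :
  let f t := C%:C * ((cos t +i* sin t) ^+ A * conjc (cos t +i* sin t) ^+ B) in
  cintegrable leb `[0, 2 * pi] f /\
  ((2 * pi)^-1)%:C * cintegral leb `[0, 2 * pi] f = ((A == B)%:R * C)%:C.
Proof.
move=> f.
have fE t : f t = (C * cos ((A%:R - B%:R) * t)) +i* (C * sin ((A%:R - B%:R) * t)).
  rewrite /f cis_mul_conj.
  by apply/eqP; rewrite eq_complex/=; apply/andP; split; apply/eqP; ring.
have [ic Ic] := integral_cos_2pi A B; have [i_s Is] := integral_sin_2pi A B.
split.
  split.
    apply: (eq_integrable _ _ _ _ (integrableZl _ C ic)) => // t _.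
    by rewrite fE.
  apply: (eq_integrable _ _ _ _ (integrableZl _ C i_s)) => // t _.
  by rewrite fE.
have -> : cintegral leb `[0, 2 * pi] f =
    (\int[leb]_(t in `[0, 2 * pi]) (C * cos ((A%:R - B%:R) * t))) +i*
    (\int[leb]_(t in `[0, 2 * pi]) (C * sin ((A%:R - B%:R) * t))).
  by congr (_ +i* _); apply: eq_Rintegral => t _; rewrite fE.
rewrite !RintegralZl// Ic Is mulr0.
apply/eqP; rewrite eq_complex/=; apply/andP; split; apply/eqP; last by ring.
by move: (@pi_gt0 R); move: pi => p p0; field; rewrite gt_eqF.
Qed.

End fourier.

(** * From the polar integral to the moments *)

Section qLaguerre_expansion.
Context {R : realType}.
Implicit Types (q alpha beta x y : R) (z w : R[i]).

Lemma realCN z x : z = x%:C -> - z = (- x)%:C.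
Proof. by move=> ->; apply/eqP; rewrite eq_complex/= oppr0 !eqxx. Qed.

Lemma realCM z w x y : z = x%:C -> w = y%:C -> z * w = (x * y)%:C.
Proof.
move=> -> ->; apply/eqP.
by rewrite eq_complex/= !mulr0 !mul0r subr0 addr0 !eqxx.
Qed.

Lemma realCX z x n : z = x%:C -> z ^+ n = (x ^+ n)%:C.
Proof. by move=> zx; elim: n => [//|n IHn]; rewrite !exprS; exact: realCM. Qed.

Lemma qLaguerreE q alpha n x : 0 < q ->
  qLaguerre q alpha n x%:C =
  (\sum_(j < n.+1) qLaguerre_coef q (q `^ (alpha + 1)) n j * x ^+ j)%:C.
Proof.
move=> q0; rewrite /qLaguerre rmorph_sum/= (reindex_inj rev_ord_inj)/=.
rewrite mulr_sumr; apply: eq_bigr => -[j /=]; rewrite ltnS => jn _.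
rewrite !subSS !subKn// /qpochs !big_cons big_nil mulr1.
have -> : q `^ ((alpha + j%:R) * j%:R) =
    (q `^ (alpha + 1)) ^+ j * q ^+ ('C(j, 2) + 'C(j, 2)).
  rewrite -!powR_mulrn ?powR_ge0 ?ltW// -powRrM -powRD ?(gt_eqF q0) ?implybT//.
  congr powR.
  suff e : j%:R * j%:R = ('C(j, 2) + 'C(j, 2) + j)%:R :> R.
    by rewrite mulrDl e !natrD; ring.
  rewrite -natrM; congr (_%:R).
  by elim: (j) => // k IH; rewrite binS bin1; lia.
etransitivity.
  apply: realCM; first exact: erefl.
  apply: realCM; first exact: erefl.
  by apply: realCX; apply: realCN; exact: erefl.
congr _%:C.
by rewrite /qLaguerre_coef [(- x) ^+ j]exprNn !invfM; ring.
Qed.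

(** Truncated subtraction merges the two cases of the definition: one of the
    two exponents is always zero, and their sum is [|m - n|]. *)
Lemma qLaguerre2E q beta m n z1 z2 :
  qLaguerre2 q beta m n z1 z2 =
  z1 ^+ (m - n) * z2 ^+ (n - m) *
  qLaguerre q (beta + (m - n + (n - m))%:R) (minn m n) (z1 * z2).
Proof.
rewrite /qLaguerre2 /qLaguerre2_ge; case: leqP => [nm|mn].
  have /eqP -> : (n - m == 0)%N by rewrite subn_eq0.
  by rewrite mulr1 addn0.
have /eqP -> : (m - n == 0)%N by rewrite subn_eq0 ltnW.
by rewrite mul1r add0n mulrC [z2 * z1]mulrC mulrC.
Qed.

End qLaguerre_expansion.

Section moments_to_polar.
Context {R : realType}.
Variables (q beta : R) (q01 : 0 < q < 1) (beta_gt : -1 < beta).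
Variables (mu : {measure set (measurableTypeR R) -> \bar R}) (M : R -> R).
Hypothesis momentE : forall s, -1 < s ->
  (\int[mu]_(x in `]0%R, +oo[) (x `^ s)%:E = (M s)%:E)%E.
Hypothesis moment_rec : forall s, -1 < s ->
  M (s + 1) = ((q `^ (s + 1))^-1 - 1) * M s.

Let q0 : 0 < q. Proof. by case/andP: q01. Qed.

Lemma integral_power_sum (I : Type) (r : seq I) (c e : I -> R) :
  (forall i, -1 < e i) ->
  let f x := \sum_(i <- r) c i * x `^ e i in
  mu.-integrable `]0, +oo[ (EFin \o f) /\
  \int[mu]_(x in `]0, +oo[) f x = \sum_(i <- r) c i * M (e i).
Proof.
move=> e1; elim: r => [|i r [ir Ir]] /=.
  split.
    apply: (eq_integrable _ _ _ _ (@integrable0 _ _ _ mu _)) => // x _.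
    by rewrite /= big_nil.
  transitivity (\int[mu]_(x in `]0, +oo[) (0 : R)).
    by apply: eq_Rintegral => x _; rewrite big_nil.
  by rewrite big_nil /Rintegral integral0.
have ii : mu.-integrable `]0, +oo[ (EFin \o (fun x => x `^ e i)).
  apply/integrableP; split.
    by apply/measurable_EFinP; exact: measurable_funTS (measurable_powR _).
  under eq_integral do rewrite /= ger0_norm ?powR_ge0//.
  by rewrite momentE// ltry.
have ici : mu.-integrable `]0, +oo[ (EFin \o (fun x => c i * x `^ e i)).
  exact: (integrableZl _ (c i) ii).
split.
  apply: (eq_integrable _ _ _ _ (integrableD _ ici ir)) => // x _.
  by rewrite /= big_cons.
transitivity (\int[mu]_(x in `]0, +oo[)
    (c i * x `^ e i + \sum_(j <- r) c j * x `^ e j)).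
  by apply: eq_Rintegral => x _; rewrite big_cons.
by rewrite RintegralD// RintegralZl// Ir big_cons /Rintegral momentE.
Qed.

(** This reduces the theorem to the moments [M] of the measure: their values
    and their recurrence. *)
Lemma polar_qLaguerre m n s t :
  let F z := qLaguerre2 q beta m n z (conjc z) *
             conjc (qLaguerre2 q beta s t z (conjc z)) in
  let alpha := beta + (m - n + (n - m))%:R in
  let N := minn m n in
  polar_integrable mu beta F /\
  polar_integral mu beta F =
    (M alpha * (qpoch (q `^ (alpha + 1)) q N / (q ^+ N * qpoch q q N)) *
     ((m == s)%:R * (n == t)%:R))%:C.
Proof.
move=> F alpha N.
pose L m n x := \sum_(j < (minn m n).+1)
  qLaguerre_coef q (q `^ (beta + (m - n + (n - m))%:R + 1)) (minn m n) j * x ^+ j.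
(* the exponents of [e^(i theta)] and of its conjugate *)
pose A := (m - n + (t - s))%N; pose B := (n - m + (s - t))%N.
have qL2 k l z x : z * conjc z = x%:C -> qLaguerre2 q beta k l z (conjc z) =
    z ^+ (k - l) * conjc z ^+ (l - k) * (L k l x)%:C.
  by move=> zx; rewrite qLaguerre2E zx qLaguerreE.
have polarE x theta : 0 < x -> polar_fun F x theta =
    (Num.sqrt x ^+ (A + B) * L m n x * L s t x)%:C *
    ((cos theta +i* sin theta) ^+ A * conjc (cos theta +i* sin theta) ^+ B).
  move=> x0; rewrite /polar_fun /F; set E := cos theta +i* sin theta.
  set r := (Num.sqrt x)%:C; have zx : (r * E) * conjc (r * E) = x%:C.
    rewrite rmorphM/= /r /E; apply/eqP; rewrite eq_complex/=.
    have := cos2Dsin2 theta; have := sqr_sqrtr (ltW x0).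
    move: (Num.sqrt x) (cos theta) (sin theta) => a b c h1 h2.
    apply/andP; split; apply/eqP; last by ring.
    by rewrite -h1 -[RHS]mulr1 -h2; ring.
  have cM (u v : R[i]) : conjc (u * v) = conjc u * conjc v by exact: rmorphM.
  have cX (u : R[i]) k : conjc (u ^+ k) = conjc u ^+ k by exact: rmorphXn.
  rewrite !(qL2 _ _ _ _ zx) !(cM, cX) !conjcK.
  have -> : conjc r = r by rewrite /r /= oppr0.
  have -> : (L s t x)%:C^* = (L s t x)%:C by rewrite /= oppr0.
  have -> : (Num.sqrt x ^+ (A + B) * L m n x * L s t x)%:C =
      r ^+ (A + B) * (L m n x)%:C * (L s t x)%:C.
    apply/esym/realCM => //; apply/realCM => //; exact: realCX.
  by rewrite !exprMn !exprD; ring.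
pose g x := (A == B)%:R * (Num.sqrt x ^+ (A + B) * L m n x * L s t x) * x `^ beta.
have cis x : 0 < x ->
    cintegrable (@lebesgue_measure R) `[0, 2 * pi] (polar_fun F x) /\
    angular_mean F x * (x `^ beta)%:C = (g x)%:C.
  move=> x0; have [ci cI] := cintegral_cis
    (Num.sqrt x ^+ (A + B) * L m n x * L s t x) A B.
  have e : polar_fun F x = fun theta =>
      (Num.sqrt x ^+ (A + B) * L m n x * L s t x)%:C *
      ((cos theta +i* sin theta) ^+ A * conjc (cos theta +i* sin theta) ^+ B).
    by apply/funext => theta; exact: polarE.
  rewrite /angular_mean e; split => //.
  rewrite cI; exact: realCM.
have pos (x : R) : x \in `]0, +oo[%classic -> 0 < x.
  by rewrite inE/= in_itv/= andbT.
(* equal frequencies and equal degrees determine both indices *)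
have iff_eq : (A == B) && (minn s t == N) = (m == s) && (n == t).
  by rewrite /A /B /N; apply/idP/idP; lia.
suff [ig Ig] : mu.-integrable `]0, +oo[ (EFin \o g) /\
    \int[mu]_(x in `]0, +oo[) g x =
    M alpha * (qpoch (q `^ (alpha + 1)) q N / (q ^+ N * qpoch q q N)) *
     ((m == s)%:R * (n == t)%:R).
  split.
    split; first by move=> x /cis[].
    split.
      by apply: (eq_integrable _ _ _ _ ig) => // x /pos /cis[_ ->].
    apply: (eq_integrable _ _ _ _ (@integrable0 _ _ _ mu _)) => // x.
    by move=> /pos /cis[_ ->].
  rewrite /polar_integral /cintegral; congr (_ +i* _).
    by rewrite -Ig; apply: eq_Rintegral => x /pos /cis[_ ->].
  transitivity (\int[mu]_(x in `]0, +oo[) (0 : R)).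
    by apply: eq_Rintegral => x /pos /cis[_ ->].
  by rewrite /Rintegral integral0.
rewrite -natrM mulnb -iff_eq.
have [AB|AB] := eqVneq A B; last first.
  rewrite /= mulr0; split.
    apply: (eq_integrable _ _ _ _ (@integrable0 _ _ _ mu _)) => // x _.
    by rewrite /= /g (negbTE AB) !mul0r.
  transitivity (\int[mu]_(x in `]0, +oo[) (0 : R)).
    by apply: eq_Rintegral => x _; rewrite /g (negbTE AB) !mul0r.
  by rewrite /Rintegral integral0.
rewrite andTb.
have d2 : (s - t + (t - s) = m - n + (n - m))%N by move: AB; rewrite /A /B; lia.
have dA : (A + B = 2 * (m - n + (n - m)))%N by move: AB; rewrite /A /B; lia.
have alpha_gt : -1 < alpha by rewrite /alpha (lt_le_trans beta_gt)// lerDl.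
set a := q `^ (alpha + 1).
pose c (p : 'I_N.+1 * 'I_(minn s t).+1) :=
  qLaguerre_coef q a N p.1 * qLaguerre_coef q a (minn s t) p.2.
pose e (p : 'I_N.+1 * 'I_(minn s t).+1) := alpha + (p.1 + p.2)%:R.
have e1 p : -1 < e p by rewrite /e (lt_le_trans alpha_gt)// lerDl.
have [iS IS] := integral_power_sum (index_enum _) c e1.
have powD x k : 0 < x -> x `^ (alpha + k%:R) = x `^ alpha * x ^+ k.
  by move=> x0; rewrite powRD ?(gt_eqF x0) ?implybT// powR_mulrn// ltW.
have gE x : 0 < x -> \sum_p c p * x `^ e p = g x.
  move=> x0; rewrite /g (introT eqP AB) mul1r dA exprM sqr_sqrtr ?ltW//.
  have -> : x ^+ (m - n + (n - m)) * L m n x * L s t x * x `^ beta =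
      x `^ alpha * (L m n x * L s t x).
    rewrite /alpha powRD ?(gt_eqF x0) ?implybT// powR_mulrn ?ltW//; ring.
  rewrite /L d2 -/alpha -/a big_distrlr/= mulr_sumr.
  rewrite -(pair_bigA _ (fun j k => c (j, k) * x `^ e (j, k)))/=.
  apply: eq_bigr => j _; rewrite mulr_sumr; apply: eq_bigr => k _.
  by rewrite /c /e powD// exprD/=; ring.
split.
  by apply: (eq_integrable _ _ _ _ iS) => // x /pos x0; rewrite /= gE.
transitivity (\int[mu]_(x in `]0, +oo[) \sum_p c p * x `^ e p).
  by apply: eq_Rintegral => x /pos x0; rewrite gE.
have a01 : 0 < a < 1.
  by apply: powR_01 => //; rewrite -ltrBlDr sub0r.
have momS k : M (alpha + k.+1%:R) = ((a * q ^+ k)^-1 - 1) * M (alpha + k%:R).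
  rewrite -natr1 addrA moment_rec; last by rewrite (lt_le_trans alpha_gt)// lerDl.
  congr ((_^-1 - 1) * _).
  by rewrite addrAC powRD ?(gt_eqF q0) ?implybT// powR_mulrn// ltW.
have := qLaguerre_orthogonal q01 a01 momS (minn s t) N.
rewrite addr0 mulrC => <-; rewrite IS.
by rewrite -(pair_bigA _ (fun j k => c (j, k) * M (e (j, k)))).
Qed.

End moments_to_polar.

(** * Integrals against a density on the half-line *)

Section density.
Context {R : realType}.
Variable w : R -> R.
Hypothesis mw : measurable_fun (`]0, +oo[ : set R) w.
Hypothesis w0 : forall x, 0 < x -> 0 <= w x.
Local Notation leb := (@lebesgue_measure R).
Local Notation D := (`]0%R, +oo[%classic : set (measurableTypeR R)).

Import HBNNSimple.

(** The identity holds for indicators by definition of the measure, hence for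
    simple functions, hence for their increasing limits. *)
Lemma ge0_integral_density (f : measurableTypeR R -> R) :
  measurable_fun D f -> (forall x, 0 < x -> 0 <= f x) ->
  (\int[density_measure mw w0]_(x in D) (f x)%:E =
   \int[leb]_(x in D) (f x * w x)%:E)%E.
Proof.
move=> mf f0; have mD : measurable D by exact: measurable_itv.
have pos (x : measurableTypeR R) : D x -> 0 < x by rewrite /= in_itv/= andbT.
have mfE : measurable_fun D (EFin \o f) by exact/measurable_EFinP.
pose f_ := nnsfun_approx mD mfE.
have f_cvg x : D x -> EFin (f_ n x) @[n --> \oo] --> (f x)%:E.
  move=> Dx; apply: (cvg_nnsfun_approx mD mfE) => //.
  by move=> y /pos y0; rewrite lee_fin f0.
have nd_f x : {homo (fun n => f_ n x) : m n / (m <= n)%N >-> m <= n}.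
  by move=> m n mn; exact/lefP/nd_nnsfun_approx.
transitivity (limn (fun n =>
    \int[density_measure mw w0]_(x in D) (f_ n x)%:E)%E).
  rewrite -monotone_convergence//.
  - by apply: eq_integral => x /[!inE] Dx; apply/esym/cvg_lim => //; exact: f_cvg.
  - by move=> n; apply/measurable_EFinP; exact: measurable_funTS.
  - by move=> n x _; rewrite lee_fin.
  - by move=> x _ m n mn; rewrite lee_fin; exact: nd_f.
transitivity (limn (fun n => \int[leb]_(x in D) (f_ n x * w x)%:E)%E); last first.
  rewrite -monotone_convergence//.
  - apply: eq_integral => x /[!inE] Dx; apply/cvg_lim => //.
    under eq_fun do rewrite EFinM.
    by rewrite EFinM; apply: cvgeZr => //; exact: f_cvg.
  - move=> n; apply/measurable_EFinP; apply: measurable_funM => //.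
    exact: measurable_funTS.
  - by move=> n x /pos x0; rewrite lee_fin mulr_ge0 ?w0.
  - by move=> x /pos x0 m n mn; rewrite lee_fin ler_wpM2r ?w0// nd_f.
congr (limn _); apply/funext => n.
have mA k : measurable (f_ n @^-1` [set k] : set (measurableTypeR R)).
  by rewrite -[_ @^-1` _]setTI; exact: measurable_funP.
transitivity (\sum_(k \in range (f_ n))
    \int[density_measure mw w0]_(x in D) (k * \1_(f_ n @^-1` [set k]) x)%:E)%E.
  under eq_integral do rewrite fimfunE -fsumEFin//.
  rewrite ge0_integral_fsum//.
  - by move=> y; apply/measurable_EFinP/measurable_funM.
  - by move=> y x _; rewrite nnfun_muleindic_ge0.
transitivity (\sum_(k \in range (f_ n))
    \int[leb]_(x in D) (k * \1_(f_ n @^-1` [set k]) x * w x)%:E)%E; last first.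
  rewrite -ge0_integral_fsum//.
  - apply: eq_integral => x _; rewrite fimfunE fsumEFin//.
    by rewrite mulr_fsuml.
  - move=> k; apply/measurable_EFinP; apply: measurable_funM => //.
    by apply: measurable_funM.
  - move=> k x /pos x0; rewrite EFinM mule_ge0 ?nnfun_muleindic_ge0//.
    by rewrite lee_fin w0.
apply: eq_fsbigr => k /[!inE] -[y _ yk].
have k0 : 0 <= k by rewrite -yk.
rewrite (integralZl_indic _ (fun k => f_ n @^-1` [set k]))//; last first.
  by move=> k0'; rewrite preimage_nnfun0.
rewrite integral_indic// /density_measure/=.
under [RHS]eq_integral do rewrite -mulrA EFinM.
rewrite ge0_integralZl//; last 2 first.
  apply/measurable_EFinP; apply: measurable_funM => //.
  by move=> x /pos x0; rewrite lee_fin mulr_ge0 ?w0.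
congr (_ * _)%E; rewrite /density_measure -setIA setIid setIC integral_mkcondr.
by apply: eq_integral => x _; rewrite restrict_EFin patch_indic/= mulrC.
Qed.

End density.

(** * Integration on the half-line *)

Section half_line.
Context {R : realType}.
Local Notation leb := (@lebesgue_measure R).
Local Notation D := (`]0%R, +oo[%classic : set (measurableTypeR R)).
Implicit Types (c s t x : R).

Lemma half_lineP x : D x <-> 0 < x.
Proof. by rewrite /= in_itv/= andbT. Qed.

Lemma lebesgue_measure_scale c (A : set (measurableTypeR R)) :
  0 < c -> measurable A ->
  (leb A = c%:E * pushforward leb ( *%R c : _ -> measurableTypeR R) A)%E.
Proof.
move=> c0 mA.
have mc : measurable_fun [set: measurableTypeR R]
  ( *%R c : measurableTypeR R -> measurableTypeR R) by exact: measurable_funM.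
pose mc_pack : {mfun measurableTypeR R >-> measurableTypeR R} :=
  HB.pack ( *%R c : measurableTypeR R -> measurableTypeR R)
    (isMeasurableFun.Build _ _ _ _ _ mc).
rewrite (@lebesgue_measure_unique _
  (mscale (NngNum (ltW c0)) (pushforward leb mc_pack)))// => _ [[a b]] _ <-.
transitivity (c%:E * leb ( *%R c @^-1` `]a, b]))%E; last by [].
rewrite (_ : _ @^-1` _ = `]a / c, b / c]%classic); last first.
  by apply/seteqP; split => x; rewrite /= !in_itv/= ltr_pdivrMr// ler_pdivlMr// mulrC.
rewrite !lebesgue_measure_itv/= !lte_fin ltr_pM2r ?invr_gt0//.
case: ifPn => _; last by rewrite mule0.
by rewrite -!EFinD -EFinM -mulrBl mulrC divfK ?gt_eqF.
Qed.

Lemma ge0_integral_scale c (f : measurableTypeR R -> R) : 0 < c ->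
  measurable_fun D f -> (forall x, 0 < x -> 0 <= f x) ->
  (\int[leb]_(x in D) (f x)%:E = c%:E * \int[leb]_(x in D) (f (c * x))%:E)%E.
Proof.
move=> c0 mf f0.
have mc : measurable_fun [set: measurableTypeR R]
  ( *%R c : measurableTypeR R -> measurableTypeR R) by exact: measurable_funM.
pose mc_pack : {mfun measurableTypeR R >-> measurableTypeR R} :=
  HB.pack ( *%R c : measurableTypeR R -> measurableTypeR R)
    (isMeasurableFun.Build _ _ _ _ _ mc).
have mfE : measurable_fun D (EFin \o f) by exact/measurable_EFinP.
have f0E x : D x -> (0 <= (f x)%:E)%E by move/half_lineP => x0; rewrite lee_fin f0.
have DE : ( *%R c : measurableTypeR R -> measurableTypeR R) @^-1` D = D.
  by apply/seteqP; split => x; rewrite /= !in_itv/= !andbT pmulr_rgt0.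
rewrite -[in RHS]DE -(@ge0_integral_pushforward _ _ _ _ _ _ mc leb D (EFin \o f))//; last first.
  by move=> x; rewrite inE => /f0E.
rewrite -(ge0_integral_mscale _ _ (NngNum (ltW c0)))//.
by apply: eq_measure_integral => A mA _; exact: lebesgue_measure_scale.
Qed.

(** Tonelli's theorem for [f] extended by zero outside the open quadrant. *)
Lemma tonelli_half_line (f : R -> R -> R) :
  measurable_fun [set: measurableTypeR R * measurableTypeR R]
    (fun z => f z.1 z.2 : R) ->
  (forall x y, 0 < x -> 0 < y -> 0 <= f x y) ->
  (\int[leb]_(x in D) \int[leb]_(y in D) (f x y)%:E =
   \int[leb]_(y in D) \int[leb]_(x in D) (f x y)%:E)%E.
Proof.
move=> mf f0.
pose g := (fun z : measurableTypeR R * measurableTypeR R =>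
  (f z.1 z.2)%:E) \_ (D `*` D).
have mg : measurable_fun setT g.
  apply/(measurable_restrictT _ _).1; first by apply: measurableX.
  by apply/measurable_EFinP; exact: measurable_funTS.
have g0 z : (0 <= g z)%E.
  rewrite /g patchE; case: ifPn => // /[!inE] -[/half_lineP ? /half_lineP ?].
  by rewrite lee_fin f0.
have e := @fubini_tonelli _ _ _ _ _ leb leb g mg g0.
rewrite [in RHS]integral_mkcond [in LHS]integral_mkcond.
transitivity (\int[leb]_x \int[leb]_y g (x, y))%E; last rewrite e.
  apply: eq_integral => x _; rewrite patchE; case: ifPn => Dx.
    rewrite integral_mkcond; apply: eq_integral => y _.
    by rewrite /g !patchE in_setX Dx.
  by rewrite integral0_eq// => y _; rewrite /g patchE in_setX (negbTE Dx).
apply: eq_integral => y _; rewrite patchE; case: ifPn => Dy.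
  rewrite [RHS]integral_mkcond; apply: eq_integral => x _.
  by rewrite /g !patchE in_setX Dy andbT.
by rewrite integral0_eq// => x _; rewrite /g patchE in_setX (negbTE Dy) andbF.
Qed.

(** [s |-> x s^(x-1)] may be unbounded at [0], so the fundamental theorem is
    applied on [[t/(n+2), t]] before letting [n] grow. *)
Lemma integral_powR t x : 0 < t -> 0 < x ->
  (\int[leb]_(s in `]0%R, t]) (x * s `^ (x - 1))%:E = (t `^ x)%:E)%E.
Proof.
move=> t0 x0.
pose F n := `[t / n.+2%:R, t]%classic : set (measurableTypeR R).
have tn n : 0 < t / n.+2%:R < t.
  by rewrite divr_gt0//= ltr_pdivrMr// ltr_pMr// ltr1n.
have UF : \bigcup_n F n = `]0, t]%classic.
  apply/seteqP; split => s.
    by move=> [n _]; rewrite /F/= !in_itv/= => /andP[/(lt_le_trans _)-> //]; case/andP: (tn n).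
  rewrite /= in_itv/= => /andP[s0 st]; exists (Num.truncn (t / s)) => //.
  rewrite /F/= in_itv/= st andbT ler_pdivrMr// mulrC -ler_pdivrMr//.
  by rewrite ltW// (lt_le_trans (truncnS_gt _))// ler_nat.
have mpow (A : set (measurableTypeR R)) :
    measurable_fun A (fun s => (x * s `^ (x - 1))%:E).
  apply/measurable_EFinP; apply: measurable_funM => //.
  exact: measurable_funTS (measurable_powR _).
have := @ge0_nondecreasing_set_cvg_integral _ _ _ F
  (fun s => (x * s `^ (x - 1))%:E) leb.
rewrite UF => cF.
have FE n : (\int[leb]_(s in F n) (x * s `^ (x - 1))%:E =
    (t `^ x - (t / n.+2%:R) `^ x)%:E)%E.
  have /andP[tn0 tnt] := tn n.
  have dpow s : 0 < s -> is_derive s 1 (fun s => s `^ x) (x * s `^ (x - 1)).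
    exact: is_derive1_powR.
  have cpow e s : 0 < s -> {for s, continuous (fun s : R => s `^ e)}.
    move=> s0; apply/differentiable_continuous/derivable1_diffP.
    exact: (@ex_derive _ _ _ _ _ _ _ (is_derive1_powR e s0)).
  rewrite (@continuous_FTC2 _ _ (fun s => s `^ x))//.
  - apply: continuous_in_subspaceT => s; rewrite inE/= in_itv/= => /andP[ts _].
    by apply: cvgM; [exact: cvg_cst|apply: cpow; exact: lt_le_trans ts].
  - split.
    + move=> s; rewrite in_itv/= => /andP[ts _].
      exact: (@ex_derive _ _ _ _ _ _ _ (dpow _ (lt_trans tn0 ts))).
    + by apply: cvg_at_right_filter; exact: cpow.
    + by apply: cvg_at_left_filter; exact: cpow.
  - move=> s; rewrite in_itv/= => /andP[ts _]; rewrite derive1E.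
    by rewrite (@derive_val _ _ _ _ _ _ _ (dpow _ (lt_trans tn0 ts))).
have lim1 : (\int[leb]_(s in F n) (x * s `^ (x - 1))%:E)%E @[n --> \oo] --> (t `^ x)%:E.
  under eq_fun do rewrite FE.
  apply: cvg_EFin; first exact: nearW.
  rewrite -[X in _ --> X]subr0; apply: cvgB; first exact: cvg_cst.
  have /cvg_at_rightP := powR_cvg0 x0; apply; split => [n|].
    by case/andP: (tn n).
  rewrite -(mulr0 t); apply: cvgM; first exact: cvg_cst.
  apply/cvgr0Pnorm_lt => e e0; near=> n.
  rewrite gtr0_norm ?invr_gt0// invf_plt ?posrE//.
  near: n; exists (Num.truncn e^-1) => // n /= en.
  by rewrite (lt_le_trans (truncnS_gt _))// ler_nat ltnS (leq_trans en).
apply: (cvg_unique _ (cF _ _ _ _) lim1) => //.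
- move=> m n mn; apply/subsetPset => s; rewrite /F/= !in_itv/= => /andP[ts ->].
  rewrite andbT; apply: le_trans ts; rewrite ler_pM2l// lef_pV2 ?posrE//.
  by rewrite ler_nat.
- by move=> n; exact: measurable_itv.
- by move=> n s _; rewrite lee_fin mulr_ge0 ?powR_ge0 ?ltW.
Unshelve. all: by end_near. Qed.

End half_line.

(** * The Gamma function *)

Section gamma.
Context {R : realType}.
Local Notation leb := (@lebesgue_measure R).
Local Notation D := (`]0%R, +oo[%classic : set (measurableTypeR R)).
Implicit Types (c s t x u alpha : R).

Lemma measurable_pow (A : set (measurableTypeR R)) x :
  measurable_fun A (fun t : measurableTypeR R => t `^ x).
Proof. exact: measurable_funTS (measurable_powR _). Qed.

Lemma measurable_expRN (A : set (measurableTypeR R)) :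
  measurable_fun A (fun t : measurableTypeR R => expR (- t)).
Proof. by apply: measurableT_comp => //; exact: measurableT_comp. Qed.

Lemma integral_expRN s :
  (\int[leb]_(t in `[s, +oo[) (expR (- t))%:E = (expR (- s))%:E)%E.
Proof.
have dF t : is_derive t 1 (fun t : R => - expR (- t)) (expR (- t)).
  have h : is_derive t 1 (fun t : R => - t) (-1).
    by have := is_deriveN (is_derive_id t (1 : R)).
  have := is_deriveN (is_derive1_comp (is_derive_expR (- t)) h).
  by move/is_derive_eq; apply; rewrite mulrN1 opprK.
have cN : continuous (fun t : R => expR (- t)).
  move=> t; apply: (@continuous_comp _ _ _ (@GRing.opp R) expR); last exact: continuous_expR.
  exact: opp_continuous.
rewrite (@ge0_continuous_FTC2y _ _ (fun t : R => - expR (- t)) s 0)//.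
- by rewrite -EFinB sub0r opprK.
- exact: continuous_subspaceT.
- by rewrite -oppr0; apply: cvgN; exact: cvgr_expR.
- by apply: cvg_at_right_filter; apply: cvgN; exact: cN.
- by move=> t _; rewrite derive1E (@derive_val _ _ _ _ _ _ _ (dF t)).
Qed.

Lemma ge0_integralZl_fin (A : set (measurableTypeR R)) c (f : measurableTypeR R -> R) :
  measurable A -> measurable_fun A f -> (forall t, A t -> 0 <= f t) -> 0 <= c ->
  (\int[leb]_(t in A) (c * f t)%:E = c%:E * \int[leb]_(t in A) (f t)%:E)%E.
Proof.
move=> mA mf f0 c0; under eq_integral do rewrite EFinM.
by apply: ge0_integralZl => //; exact/measurable_EFinP.
Qed.

Lemma mem_set_pred (P : measurableTypeR R -> bool) t :
  (t \in [set t : measurableTypeR R | P t]) = P t.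
Proof. by apply/idP/idP => [/set_mem|/mem_set]. Qed.

Definition Euler_integral_ereal x : \bar R :=
  (\int[leb]_(t in D) (t `^ (x - 1) * expR (- t))%:E)%E.

Local Notation EI := Euler_integral_ereal.

Lemma Euler_integralE x : Euler_integral x = fine (EI x).
Proof. by []. Qed.

Lemma measurable_Euler (A : set (measurableTypeR R)) x :
  measurable_fun A (fun t : measurableTypeR R => t `^ (x - 1) * expR (- t)).
Proof. by apply: measurable_funM; [exact: measurable_pow|exact: measurable_expRN]. Qed.

Let measurable_xpow (A : set (measurableTypeR R)) x :
  measurable_fun A (fun t : measurableTypeR R => x * t `^ (x - 1)).
Proof. by apply: measurable_funM => //; exact: measurable_pow. Qed.

Let Euler_ge0 x t : 0 <= t `^ (x - 1) * expR (- t).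
Proof. by rewrite mulr_ge0 ?powR_ge0 ?expR_ge0. Qed.

Lemma Euler_integral_ereal_ge0 x : (0 <= EI x)%E.
Proof. by apply: integral_ge0 => t _; rewrite lee_fin mulr_ge0 ?powR_ge0 ?expR_ge0. Qed.

(** Both sides are [x s^(x-1) e^(-t)] integrated over [0 < s <= t]. *)
Lemma Euler_integral_erealS x : 0 < x -> EI (x + 1) = (x%:E * EI x)%E.
Proof.
move=> x0.
pose f s t := if s <= t then x * s `^ (x - 1) * expR (- t) else 0.
have mf : measurable_fun [set: measurableTypeR R * measurableTypeR R]
    (fun z => f z.1 z.2 : R).
  apply: measurable_fun_ifT.
  - exact: measurable_fun_ler.
  - apply: measurable_funM; last first.
      by apply: measurableT_comp => //; exact: measurableT_comp.
    apply: measurable_funM => //.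
    by apply: (measurableT_comp (measurable_powR (x - 1))).
  - exact: measurable_cst.
have f0 s t : 0 < s -> 0 < t -> 0 <= f s t.
  move=> _ _; rewrite /f; case: ifP => // _.
  by rewrite !mulr_ge0 ?powR_ge0 ?expR_ge0 ?ltW.
have := tonelli_half_line mf f0.
have -> : (\int[leb]_(s in D) \int[leb]_(t in D) (f s t)%:E = x%:E * EI x)%E.
  rewrite /EI -(ge0_integralZl_fin _ (@measurable_Euler D x))//; last exact: ltW.
  apply: eq_integral => s; rewrite inE => /half_lineP s0.
  transitivity (\int[leb]_(t in `[s, +oo[) (x * s `^ (x - 1) * expR (- t))%:E)%E.
    have -> : `[s, +oo[%classic = D `&` [set t : measurableTypeR R | s <= t].
      apply/seteqP; split => t; rewrite /= !in_itv/= !andbT.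
        by move=> st; split => //; exact: lt_le_trans st.
      by move=> [].
    rewrite [RHS]integral_mkcondr; apply: eq_integral => t _.
    by rewrite patchE mem_set_pred /f; case: (s <= t).
  rewrite (ge0_integralZl_fin _ (@measurable_expRN _))//.
  - by rewrite integral_expRN -!EFinM mulrA.
  - by rewrite mulr_ge0 ?powR_ge0 ?ltW.
move=> ->; rewrite /EI; apply: eq_integral => t; rewrite inE => /half_lineP t0.
transitivity (\int[leb]_(s in `]0%R, t]) (expR (- t) * (x * s `^ (x - 1)))%:E)%E; last first.
  have -> : `]0, t]%classic = D `&` [set s : measurableTypeR R | s <= t].
    apply/seteqP; split => s; rewrite /= !in_itv/= !andbT.
      by move=> /andP[].
    by move=> [-> ->].
  rewrite integral_mkcondr; apply: eq_integral => s _.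
  by rewrite patchE mem_set_pred /f; case: (s <= t); rewrite // mulrC.
rewrite (ge0_integralZl_fin _ (measurable_xpow _))//.
- by rewrite integral_powR// -EFinM mulrC addrK.
- by move=> s _; rewrite mulr_ge0 ?powR_ge0 ?ltW.
Qed.

(** For [x <= 1] the integrand is at most [t^(x-1)] on [(0, 1]] and [e^(-t)]
    beyond; the functional equation reduces the other [x] to this case. *)
Lemma Euler_integral_ereal_fin x : 0 < x -> EI x \is a fin_num.
Proof.
move=> x0; rewrite ge0_fin_numE ?Euler_integral_ereal_ge0//.
have [k] : exists k, x <= k.+1%:R.
  by exists (Num.truncn x); exact/ltW/truncnS_gt.
elim: k x x0 => [|k IHk] x x0 xk; last first.
  have [x1|x1] := leP x 1; first by apply: IHk => //; rewrite (le_trans x1)// ler1n.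
  rewrite -(subrK 1 x) Euler_integral_erealS ?subr_gt0//.
  have h : x - 1 <= k.+1%:R by rewrite lerBlDr natr1.
  rewrite lte_mul_pinfty//; first by rewrite lee_fin subr_ge0 ltW.
  by apply: IHk; rewrite ?subr_gt0.
have -> : EI x = (\int[leb]_(t in `]0%R, 1%R]) (t `^ (x - 1) * expR (- t))%:E +
    \int[leb]_(t in `]1%R, +oo[) (t `^ (x - 1) * expR (- t))%:E)%E.
  rewrite -ge0_integral_setU//=; last 3 first.
  - by apply/measurable_EFinP; exact: measurable_Euler.
  - by move=> t _; rewrite lee_fin.
  - apply/disj_setPS => t [/=]; rewrite !in_itv/= andbT => /andP[_ t1].
    by rewrite ltNge t1.
  congr (integral _ _ _); apply/seteqP; split => t; rewrite /= !in_itv/= !andbT.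
    by move=> ->; have [?|?] := leP t 1; [left|right].
  by move=> [/andP[]//|]; exact: lt_trans.
apply: lte_add_pinfty.
  apply: (@le_lt_trans _ _ (\int[leb]_(t in `]0%R, 1%R]) (x^-1 * (x * t `^ (x - 1)))%:E)%E).
    apply: ge0_le_integral => //.
    - by move=> t _; rewrite lee_fin.
    - by apply/measurable_EFinP; exact: measurable_Euler.
    - by apply/measurable_EFinP; apply: measurable_funM.
    - move=> t; rewrite /= in_itv/= => /andP[t0 _]; rewrite lee_fin mulKf ?gt_eqF//.
      by rewrite ler_piMr ?powR_ge0// -expR0 ler_expR oppr_le0 ltW.
  rewrite (ge0_integralZl_fin _ (measurable_xpow _))//.
  - by rewrite integral_powR// -EFinM ltry.
  - by move=> t _; rewrite mulr_ge0 ?powR_ge0 ?ltW.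
  - by rewrite invr_ge0 ltW.
apply: (@le_lt_trans _ _ (\int[leb]_(t in `]1%R, +oo[) (expR (- t))%:E)%E).
  apply: ge0_le_integral => //.
  - by move=> t _; rewrite lee_fin.
  - by apply/measurable_EFinP; exact: measurable_Euler.
  - by apply/measurable_EFinP; exact: measurable_expRN.
  - move=> t; rewrite /= in_itv/= andbT => t1; rewrite lee_fin.
    rewrite ler_piMl ?expR_ge0// -[leRHS](powRr0 t) ler_powR ?(ltW t1)//.
    by rewrite subr_le0.
rewrite integral_itv_obnd_cbnd ?integral_expRN ?ltry//.
by apply/measurable_EFinP; exact: measurable_expRN.
Qed.

Lemma Euler_integralS x : 0 < x -> Euler_integral (x + 1) = x * Euler_integral x.
Proof.
move=> x0; rewrite !Euler_integralE Euler_integral_erealS// fineM//.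
exact: Euler_integral_ereal_fin.
Qed.

(** Euler's beta integral: both factors are integrals of exponentials, and
    [1/(1+x)] is the integral of [e^(-(1+x)u)] over [u]. *)
Lemma integral_beta alpha : -1 < alpha < 0 ->
  (\int[leb]_(x in D) (x `^ alpha / (1 + x))%:E =
   (Euler_integral (- alpha) * Euler_integral (alpha + 1))%:E)%E.
Proof.
move=> /andP[a1 a0].
pose f x u := x `^ alpha * expR (- ((1 + x) * u)).
have mf : measurable_fun [set: measurableTypeR R * measurableTypeR R]
    (fun z => f z.1 z.2 : R).
  apply: measurable_funM; first by apply: (measurableT_comp (measurable_powR alpha)).
  apply: measurableT_comp => //; apply: measurableT_comp => //.
  by apply: measurable_funM => //; apply: measurable_funD.
have f0 x u : 0 < x -> 0 < u -> 0 <= f x u.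
  by rewrite mulr_ge0 ?powR_ge0 ?expR_ge0.
have := tonelli_half_line mf f0.
have exp1 : (\int[leb]_(u in D) (expR (- u))%:E = 1%:E)%E.
  rewrite integral_itv_obnd_cbnd ?integral_expRN ?oppr0 ?expR0//.
  by apply/measurable_EFinP; exact: measurable_expRN.
have -> : (\int[leb]_(x in D) \int[leb]_(u in D) (f x u)%:E =
    \int[leb]_(x in D) (x `^ alpha / (1 + x))%:E)%E.
  apply: eq_integral => x; rewrite inE => /half_lineP x0.
  have x10 : 0 < 1 + x by rewrite addr_gt0.
  have me : measurable_fun D (fun u : measurableTypeR R => expR (- ((1 + x) * u))).
    apply: (measurableT_comp (@measurable_expR R)).
    by apply: measurableT_comp => //; exact: measurable_funM.
  rewrite /f (ge0_integralZl_fin _ me) ?powR_ge0// EFinM; congr (_ * _)%E.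
  have := @ge0_integral_scale _ (1 + x) (fun u => expR (- u)) x10 (@measurable_expRN _)
    (fun u _ => expR_ge0 (- u)).
  rewrite exp1; set I := (\int[leb]_(_ in _) _)%E => e.
  have -> : I = ((1 + x)^-1%:E * ((1 + x)%:E * I))%E.
    by rewrite muleA -EFinM mulVf ?gt_eqF// mul1e.
  by rewrite -e -EFinM mulr1.
move=> ->.
have Ea : EI (alpha + 1) \is a fin_num.
  by apply: Euler_integral_ereal_fin; rewrite -ltrBlDr sub0r.
have Eb : EI (- alpha) \is a fin_num.
  by apply: Euler_integral_ereal_fin; rewrite oppr_gt0.
rewrite !Euler_integralE EFinM (fineK Ea) (fineK Eb) muleC.
transitivity (\int[leb]_(u in D)
   (fine (EI (alpha + 1)) * (u `^ (- alpha - 1) * expR (- u)))%:E)%E; last first.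
  rewrite (ge0_integralZl_fin _ (@measurable_Euler _ _))//.
    by rewrite (fineK Ea).
  by rewrite fine_ge0// Euler_integral_ereal_ge0.
apply: eq_integral => u; rewrite inE => /half_lineP u0.
have e := @ge0_integral_scale _ u (fun x => x `^ (alpha + 1 - 1) * expR (- x)) u0
  (@measurable_Euler _ _) (fun x _ => Euler_ge0 _ x).
rewrite -[LHS]/(EI (alpha + 1)) addrK in e.
have me : measurable_fun D
    (fun x : measurableTypeR R => x `^ alpha * expR (- (u * x))).
  apply: measurable_funM; first exact: measurable_pow.
  apply: (measurableT_comp (@measurable_expR R)).
  by apply: measurableT_comp => //; exact: measurable_funM.
set J := (\int[leb]_(x in D) (x `^ alpha * expR (- (u * x)))%:E)%E.
have eJ : EI (alpha + 1) = ((u `^ (alpha + 1))%:E * J)%E.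
  have pu : u `^ (alpha + 1) = u * u `^ alpha.
    by rewrite powRD ?(gt_eqF u0) ?implybT// powRr1 1?mulrC// ltW.
  rewrite e pu EFinM -muleA; congr (_ * _)%E; rewrite -ge0_integralZl_fin ?powR_ge0//; last first.
    by move=> x _; rewrite mulr_ge0 ?powR_ge0 ?expR_ge0.
  apply: eq_integral => x; rewrite inE => /half_lineP x0.
  by rewrite powRM ?ltW// mulrA.
have upos : u `^ (alpha + 1) != 0 by rewrite gt_eqF ?powR_gt0.
have -> : (\int[leb]_(x in D) (f x u)%:E = (expR (- u))%:E * J)%E.
  rewrite -ge0_integralZl_fin ?expR_ge0//; last first.
    by move=> x _; rewrite mulr_ge0 ?powR_ge0 ?expR_ge0.
  apply: eq_integral => x _; congr EFin; rewrite /f mulrDl mul1r opprD expRD.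
  by rewrite [x * u]mulrC mulrCA.
have pV : u `^ (- alpha - 1) = (u `^ (alpha + 1))^-1 by rewrite -opprD powRN.
have p1 : ((u `^ (alpha + 1))%:E * ((u `^ (alpha + 1))^-1)%:E = 1)%E.
  by rewrite -EFinM mulfV.
rewrite EFinM (fineK Ea) eJ pV EFinM muleACA p1 mul1e.
by rewrite muleC.
Qed.

End gamma.

(** * Infinite q-products *)

Section infinite_qproducts.
Context {R : realType}.
Variable q : R.
Hypothesis q01 : 0 < q < 1.
Implicit Types (a b : R).

Let q0 : 0 < q. Proof. by case/andP: q01. Qed.
Let q1 : q < 1. Proof. by case/andP: q01. Qed.

Lemma cvg_expr0 : q ^+ n @[n --> \oo] --> (0 : R).
Proof. by apply: cvg_expr; rewrite ger0_norm// ltW. Qed.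

Lemma exists_expr_lt (e : R) : 0 < e -> exists n, q ^+ n < e.
Proof.
move=> e0; have /cvgr0Pnorm_lt/(_ _ e0)[n _ /(_ n (leqnn n))/=] := cvg_expr0.
by exists n; rewrite -[ltLHS]ger0_norm// exprn_ge0// ltW.
Qed.

Lemma qpoch_le1 a n : 0 <= a <= 1 -> 0 <= qpoch a q n <= 1.
Proof.
move=> /andP[a0 a1]; elim: n => [|n /andP[h0 h1]]; first by rewrite qpoch0 ler01 lexx.
have qn : 0 <= a * q ^+ n <= 1.
  by rewrite mulr_ge0 ?exprn_ge0 ?mulr_ile1 ?exprn_ge0 ?exprn_ile1 ?(ltW q0) ?(ltW q1).
have /andP[l u] := qn.
by rewrite qpochSr mulr_ge0 ?subr_ge0//= mulr_ile1 ?subr_ge0// gerBl.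
Qed.

Let qpoch_shift a N :
  (fun n => qpoch a q (n + N)) = (fun n => qpoch a q N * qpoch (a * q ^+ N) q n).
Proof. by apply/funext => n; rewrite addnC qpochD. Qed.

Lemma is_cvg_qpoch_real a : cvgn (qpoch a q).
Proof.
have [a0|a0] := leP a 0; first exact: is_cvg_qpoch.
have le1 b : 0 <= b <= 1 -> cvgn (qpoch b q).
  move=> b01; apply: nonincreasing_is_cvgn; last first.
    by exists 0 => _ [n _ <-]; case/andP: (qpoch_le1 n b01).
  apply/nonincreasing_seqP => n; rewrite qpochSr ler_piMr//.
    by case/andP: (qpoch_le1 n b01).
  by rewrite gerBl mulr_ge0 ?exprn_ge0 ?(ltW q0)//; case/andP: b01.
have [N hN] : exists N, q ^+ N < a^-1 by apply: exists_expr_lt; rewrite invr_gt0.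
have /le1 cN : 0 <= a * q ^+ N <= 1.
  rewrite mulr_ge0 ?exprn_ge0 ?(ltW a0) ?(ltW q0)//=.
  by rewrite mulrC -ler_pdivlMr// mul1r ltW.
apply/cvg_ex; exists (qpoch a q N * qpoch_inf (a * q ^+ N) q).
rewrite -(cvg_shiftn N) qpoch_shift.
by apply: cvgM; [exact: cvg_cst|exact: cN].
Qed.

Lemma cvg_qpoch a : qpoch a q n @[n --> \oo] --> qpoch_inf a q.
Proof. exact: is_cvg_qpoch_real. Qed.

Lemma qpoch_infD a n : qpoch_inf a q = qpoch a q n * qpoch_inf (a * q ^+ n) q.
Proof.
apply/cvg_lim => //; rewrite -(cvg_shiftn n) qpoch_shift.
by apply: cvgM; [exact: cvg_cst|exact: cvg_qpoch].
Qed.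

Lemma qpoch_infS a : qpoch_inf a q = (1 - a) * qpoch_inf (a * q) q.
Proof. by rewrite (qpoch_infD a 1) qpochSr qpoch0 mul1r expr1 expr0 mulr1. Qed.

(** If [0 < a < 1] then [1 - a q^k] is at least [1 / (1 - b q^k)] for
    [b = - a/(1-a)], so the product is at least [1 / (b; q)_oo]. *)
Lemma qpoch_inf_gt0 a : a < 1 -> 0 < qpoch_inf a q.
Proof.
move=> a1; have [a0|a0] := leP a 0.
  by rewrite (lt_le_trans ltr01)// qpoch_inf_ge1.
set b := - (a / (1 - a)).
have a1' : 0 < 1 - a by rewrite subr_gt0.
have b0 : b <= 0 by rewrite oppr_le0 divr_ge0 ?ltW.
have Pb n : 0 < qpoch b q n by rewrite (lt_le_trans ltr01)// qpoch_ge1.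
have le1 n : 1 <= qpoch a q n * qpoch b q n.
  elim: n => [|n IHn]; first by rewrite !qpoch0 mulr1.
  rewrite !qpochSr mulrACA -[leLHS]mulr1 ler_pM// /b.
  have [x0 x1] : 0 < q ^+ n /\ q ^+ n <= 1.
    by rewrite exprn_gt0// exprn_ile1// ltW.
  rewrite -subr_ge0; move: (q ^+ n) x0 x1 => x x0 x1.
  have -> : (1 - a * x) * (1 - - (a / (1 - a)) * x) - 1 =
      a ^+ 2 * x * (1 - x) / (1 - a) by field; rewrite gt_eqF.
  by rewrite divr_ge0 ?mulr_ge0 ?sqr_ge0 ?subr_ge0// ltW.
have b1 := qpoch_inf_ge1 q01 b0.
have : 1 <= qpoch_inf a q * qpoch_inf b q.
  have h : qpoch a q n * qpoch b q n @[n --> \oo] --> qpoch_inf a q * qpoch_inf b q.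
    by apply: cvgM; exact: cvg_qpoch.
  rewrite -(cvg_lim _ h)//; apply: limr_ge; first by apply/cvg_ex; eexists; exact: h.
  exact: nearW.
move=> /(lt_le_trans ltr01); rewrite pmulr_lgt0//.
by rewrite (lt_le_trans ltr01).
Qed.

Lemma qpoch_inf_neq0 a : a < 1 -> qpoch_inf a q != 0.
Proof. by move=> a1; rewrite gt_eqF// qpoch_inf_gt0. Qed.

Lemma qpoch_inf_anti a b : b <= a -> a <= 0 -> qpoch_inf a q <= qpoch_inf b q.
Proof.
move=> ba a0; apply: ler_lim; [exact: is_cvg_qpoch_real|exact: is_cvg_qpoch_real|].
apply: nearW => n; apply: ler_prod => k _.
have qk : 0 <= q ^+ k by rewrite exprn_ge0// ltW.
by rewrite subr_ge0 (le_trans _ ler01) ?mulr_le0_ge0//= lerD2l lerN2 ler_wpM2r.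
Qed.

Lemma qpoch_le_inf a n : a <= 0 -> qpoch a q n <= qpoch_inf a q.
Proof.
move=> a0; rewrite (qpoch_infD a n) ler_peMr//.
  by rewrite (le_trans ler01)// qpoch_ge1.
by rewrite qpoch_inf_ge1// mulr_le0_ge0// exprn_ge0// ltW.
Qed.

Lemma qpoch_inf_le a n : 0 <= a < 1 -> qpoch_inf a q <= qpoch a q n.
Proof.
move=> /andP[a0 a1]; apply: limr_le; first exact: is_cvg_qpoch_real.
exists n => // m /= nm; rewrite -(subnKC nm) qpochD ler_piMr//.
  by rewrite ltW// qpoch_gt0.
apply: (proj2 (andP (qpoch_le1 _ _))).
by rewrite mulr_ge0 ?exprn_ge0 ?mulr_ile1 ?exprn_ge0 ?exprn_ile1 ?(ltW q0) ?(ltW q1) ?(ltW a1).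
Qed.

Lemma qpoch_inf_expr_cvg1 : qpoch_inf (q ^+ n.+1) q @[n --> \oo] --> (1 : R).
Proof.
have Q0 : qpoch_inf q q != 0 by exact: qpoch_inf_neq0.
have e n : qpoch_inf (q ^+ n.+1) q = qpoch_inf q q / qpoch q q n.
  by rewrite (qpoch_infD q n) -exprS mulrAC divff ?mul1r// qpoch_neq0.
under eq_fun do rewrite e.
rewrite -(divff Q0); apply: cvgM; first exact: cvg_cst.
by apply: cvgV => //; exact: cvg_qpoch.
Qed.

End infinite_qproducts.

(** * Densities with [w (q x) = (1 + x) w x] *)

Section q_periodic_density.
Context {R : realType}.
Local Notation leb := (@lebesgue_measure R).
Local Notation D := (`]0%R, +oo[%classic : set (measurableTypeR R)).
Implicit Types (s t x : R).

Lemma powR_interp x (a b s : R) : 0 < x -> a <= s <= b -> x `^ s <= x `^ a + x `^ b.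
Proof.
move=> x0 /andP[as_ sb]; have [x1|/ltW x1] := leP x 1.
  by apply: ler_wpDr; rewrite ?powR_ge0// ger_powR ?x0.
by apply: ler_wpDl; rewrite ?powR_ge0// ler_powR.
Qed.

Variable q : R.
Hypothesis q01 : 0 < q < 1.
Let q0 : 0 < q. Proof. by case/andP: q01. Qed.

Variable w : R -> R.
Hypothesis mw : measurable_fun (`]0, +oo[ : set R) w.
Hypothesis w0 : forall x, 0 < x -> 0 <= w x.
Hypothesis wq : forall x, 0 < x -> w (q * x) = (1 + x) * w x.

Definition density_moment s : \bar R := (\int[leb]_(x in D) (x `^ s * w x)%:E)%E.

Lemma measurable_moment s : measurable_fun D (fun x : measurableTypeR R => x `^ s * w x).
Proof. by apply: measurable_funM => //; exact: measurable_pow. Qed.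

Lemma moment_ge0 s x : 0 < x -> 0 <= x `^ s * w x.
Proof. by move=> x0; rewrite mulr_ge0 ?powR_ge0 ?w0. Qed.

Lemma density_moment_ge0 s : (0 <= density_moment s)%E.
Proof. by apply: integral_ge0 => x /half_lineP x0; rewrite lee_fin moment_ge0. Qed.

(** Substitute [q x] for [x] and use [w (q x) = (1 + x) w x]. *)
Lemma density_moment_scale s :
  density_moment s =
  ((q `^ (s + 1))%:E * (density_moment s + density_moment (s + 1)))%E.
Proof.
rewrite {1}/density_moment (ge0_integral_scale q0 (measurable_moment s) (moment_ge0 s)).
rewrite /density_moment -ge0_integralD//; last 4 first.
- by move=> x /half_lineP x0; rewrite lee_fin moment_ge0.
- by apply/measurable_EFinP; exact: measurable_moment.
- by move=> x /half_lineP x0; rewrite lee_fin moment_ge0.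
- by apply/measurable_EFinP; exact: measurable_moment.
rewrite powRD ?(gt_eqF q0) ?implybT// powRr1 ?ltW// mulrC EFinM -muleA.
congr (_ * _)%E.
transitivity (\int[leb]_(x in D)
    (q `^ s * (x `^ s * w x + x `^ (s + 1) * w x))%:E)%E.
  apply: eq_integral => x; rewrite inE => /half_lineP x0.
  rewrite wq// powRM ?ltW// powRD ?(gt_eqF x0) ?implybT// powRr1 ?ltW//.
  by congr EFin; ring.
have mD : measurable_fun D (fun x : measurableTypeR R =>
    x `^ s * w x + x `^ (s + 1) * w x).
  by apply: measurable_funD; exact: measurable_moment.
rewrite (ge0_integralZl_fin _ mD) ?powR_ge0//.
by move=> x /half_lineP x0; rewrite addr_ge0// moment_ge0.
Qed.

Hypothesis fin_small : forall s, -1 < s < 0 -> (density_moment s < +oo)%E.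

Lemma density_moment_interp (a b s : R) : a <= s <= b ->
  (density_moment s <= density_moment a + density_moment b)%E.
Proof.
move=> asb; rewrite /density_moment -ge0_integralD//; last 4 first.
- by move=> x /half_lineP x0; rewrite lee_fin moment_ge0.
- by apply/measurable_EFinP; exact: measurable_moment.
- by move=> x /half_lineP x0; rewrite lee_fin moment_ge0.
- by apply/measurable_EFinP; exact: measurable_moment.
apply: ge0_le_integral => //.
- by move=> x /half_lineP x0; rewrite lee_fin moment_ge0.
- by apply/measurable_EFinP; exact: measurable_moment.
- by apply: emeasurable_funD; apply/measurable_EFinP; exact: measurable_moment.
- move=> x /half_lineP x0; rewrite lee_fin -mulrDl ler_wpM2r ?w0//.
  exact: powR_interp.
Qed.

Lemma density_moment_finS s : -1 < s ->
  (density_moment s < +oo)%E -> (density_moment (s + 1) < +oo)%E.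
Proof.
move=> s1; have := density_moment_scale s.
have := density_moment_ge0 s; have := density_moment_ge0 (s + 1).
case: (density_moment s) => [a| |] //; case: (density_moment (s + 1)) => [b| |] //.
  by move=> *; exact: ltry.
by rewrite addey// mulry gtr0_sg ?powR_gt0// mul1e.
Qed.

(** The recurrence carries finiteness from [(-1, 0)] upwards to all exponents but
    the natural numbers; for these it starts from the exponent [0], where
    [1 <= x^(-1/2) + x^(1/2)]. *)
Lemma density_moment_fin s : -1 < s -> (density_moment s < +oo)%E.
Proof.
move=> s1; have [k] : exists k, s < k%:R.
  by exists (Num.truncn s).+1; exact: truncnS_gt.
elim: k s s1 => [|k IHk] s s1 sk; first by rewrite fin_small// s1.
have [s0|s0|s0] := ltgtP s 0; first by rewrite fin_small// s1.
  rewrite -(subrK 1 s); apply: density_moment_finS; first by rewrite ltrBrDr addNr.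
  by apply: IHk; rewrite ?ltrBrDr ?addNr// ltrBlDr natr1.
rewrite s0; apply: (le_lt_trans (@density_moment_interp (- 2^-1) (2^-1) 0 _)); first lra.
apply: lte_add_pinfty; first by apply: fin_small; lra.
have -> : 2^-1 = - 2^-1 + 1 :> R by lra.
by apply: density_moment_finS; [lra|apply: fin_small; lra].
Qed.

Lemma density_moment_rec s : -1 < s ->
  fine (density_moment (s + 1)) = ((q `^ (s + 1))^-1 - 1) * fine (density_moment s).
Proof.
move=> s1; have := density_moment_scale s.
have s1' : -1 < s + 1 by lra.
have := density_moment_fin s1; have := density_moment_fin s1'.
have := density_moment_ge0 s; have := density_moment_ge0 (s + 1).
case: (density_moment s) => [a| |] //; case: (density_moment (s + 1)) => [b| |] //.
move=> _ _ _ _ [/=].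
have := powR_gt0 (s + 1) q0; move: (q `^ (s + 1)) => p p0 e.
have pn0 : p != 0 by rewrite gt_eqF.
have -> : b = p^-1 * (p * (a + b)) - a by field.
by rewrite -e; ring.
Qed.

Lemma density_momentE s : -1 < s ->
  (\int[density_measure mw w0]_(x in `]0%R, +oo[) (x `^ s)%:E =
   (fine (density_moment s))%:E)%E.
Proof.
move=> s1; rewrite (ge0_integral_density mw w0); last 2 first.
- exact: measurable_pow.
- by move=> x _; exact: powR_ge0.
by rewrite fineK// ge0_fin_numE ?density_moment_ge0 ?density_moment_fin.
Qed.

End q_periodic_density.

(** * The weight [1 / (-x; q)_oo] *)

Section weight1.
Context {R : realType}.
Local Notation leb := (@lebesgue_measure R).
Local Notation D := (`]0%R, +oo[%classic : set (measurableTypeR R)).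
Implicit Types (s t x alpha : R).
Variable q : R.
Hypothesis q01 : 0 < q < 1.
Let q0 : 0 < q. Proof. by case/andP: q01. Qed.
Let q1 : q < 1. Proof. by case/andP: q01. Qed.

Lemma weight1_scale x : 0 < x -> weight1 q (q * x) = (1 + x) * weight1 q x.
Proof.
move=> x0; rewrite /weight1 (qpoch_infS q01 (- x)) opprK invfM mulVKf.
  by rewrite mulNr [x * q]mulrC.
by rewrite gt_eqF// addr_gt0.
Qed.

Lemma qpochN_ge1 x n : 0 < x -> 1 <= qpoch (- x) q n.
Proof. by move=> x0; rewrite qpoch_ge1// oppr_le0 ltW. Qed.

Lemma qpochN_gt0 x n : 0 < x -> 0 < qpoch (- x) q n.
Proof. by move=> x0; rewrite (lt_le_trans ltr01)// qpochN_ge1. Qed.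

Lemma measurable_qpoch (A : set (measurableTypeR R)) (f : measurableTypeR R -> R) n :
  measurable_fun A f -> measurable_fun A (fun x => qpoch (f x) q n).
Proof.
move=> mf; elim: n => [|n IHn].
  by under eq_fun do rewrite qpoch0; exact: measurable_cst.
under eq_fun do rewrite qpochSr.
by apply: measurable_funM => //; apply: measurable_funB => //; exact: measurable_funM.
Qed.

Lemma measurable_qpochV (A : set (measurableTypeR R)) n : A `<=` D -> measurable A ->
  measurable_fun A (fun x : measurableTypeR R => (qpoch (- x) q n)^-1).
Proof.
move=> AD mA; apply: (@measurable_fun_invr_ge0 R _ _ A (fun x => qpoch (- x) q n)).
  by apply: measurable_qpoch; apply: measurable_funTS; exact: oppr_measurable.
by move=> x /AD /half_lineP x0; exact: (ltW (qpochN_gt0 n x0)).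
Qed.

Definition truncated_moment n alpha : \bar R :=
  (\int[leb]_(x in D) (x `^ alpha / qpoch (- x) q n)%:E)%E.

Lemma measurable_truncated n alpha :
  measurable_fun D (fun x : measurableTypeR R => x `^ alpha / qpoch (- x) q n).
Proof. by apply: measurable_funM; [exact: measurable_pow|exact: measurable_qpochV]. Qed.

Lemma truncated_ge0 n alpha x : 0 < x -> 0 <= x `^ alpha / qpoch (- x) q n.
Proof.
by move=> x0; rewrite mulr_ge0 ?powR_ge0// invr_ge0 (ltW (qpochN_gt0 n x0)).
Qed.

(** [1 + x q^(n+1) = (1 - q^(n+1)) + q^(n+1) (1 + x)], divided by
    [(-x; q)_(n+2)]; the last term then has the denominator [(-q x; q)_(n+1)],
    and [q x] is substituted for [x]. *)
Lemma truncated_moment_rec n alpha :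
  truncated_moment n.+1 alpha =
  ((1 - q ^+ n.+1)%:E * truncated_moment n.+2 alpha +
   (q ^+ n.+1 / q `^ (alpha + 1))%:E * truncated_moment n.+1 alpha)%E.
Proof.
have qn : 0 <= 1 - q ^+ n.+1 by rewrite subr_ge0 exprn_ile1 ?(ltW q0) ?(ltW q1).
have qn0 : 0 <= q ^+ n.+1 by rewrite exprn_ge0 ?ltW.
have mq : measurable_fun D (fun x : measurableTypeR R => x `^ alpha / qpoch (- (q * x)) q n.+1).
  apply: measurable_funM; first exact: measurable_pow.
  apply: (@measurable_fun_invr_ge0 R _ _ D (fun x => qpoch (- (q * x)) q n.+1)).
    apply: measurable_qpoch; apply: (measurableT_comp (@oppr_measurable R _)).
    exact: measurable_funM.
  by move=> x /half_lineP x0; exact: (ltW (qpochN_gt0 _ (mulr_gt0 q0 x0))).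
have mq0 x : 0 < x -> 0 <= x `^ alpha / qpoch (- (q * x)) q n.+1.
  move=> x0; rewrite mulr_ge0 ?powR_ge0// invr_ge0.
  exact: (ltW (qpochN_gt0 _ (mulr_gt0 q0 x0))).
have -> : ((q ^+ n.+1 / q `^ (alpha + 1))%:E * truncated_moment n.+1 alpha =
   \int[leb]_(x in D) (q ^+ n.+1 * (x `^ alpha / qpoch (- (q * x)) q n.+1))%:E)%E.
  have p0 : q `^ (alpha + 1) != 0 by rewrite gt_eqF ?powR_gt0.
  have mq0' x : D x -> 0 <= x `^ alpha / qpoch (- (q * x)) q n.+1.
    by move/half_lineP; exact: mq0.
  rewrite (ge0_integralZl_fin (measurable_itv _) mq mq0' qn0) {1}/truncated_moment.
  rewrite (ge0_integral_scale q0 (measurable_truncated n.+1 alpha)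
     (truncated_ge0 n.+1 alpha)).
  rewrite muleA -EFinM.
  transitivity ((q ^+ n.+1 / q `^ (alpha + 1) * q)%:E *
     ((q `^ alpha)%:E * \int[leb]_(x in D) (x `^ alpha / qpoch (- (q * x)) q n.+1)%:E))%E.
    congr (_ * _)%E.
    rewrite -(ge0_integralZl_fin (measurable_itv _) mq mq0' (powR_ge0 _ _)).
    apply: eq_integral => x; rewrite inE => /half_lineP x0.
    by rewrite powRM ?ltW// mulrA.
  rewrite muleA -EFinM; congr (_%:E * _)%E.
  rewrite powRD ?(gt_eqF q0) ?implybT// powRr1 ?ltW//; field.
  by rewrite !gt_eqF ?powR_gt0.
have t0 x : D x -> 0 <= x `^ alpha / qpoch (- x) q n.+2.
  by move/half_lineP; exact: truncated_ge0.
rewrite -(ge0_integralZl_fin (measurable_itv _) (measurable_truncated n.+2 alpha) t0 qn).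
rewrite -ge0_integralD//; last 4 first.
- by move=> x /half_lineP x0; rewrite lee_fin mulr_ge0 ?truncated_ge0.
- by apply/measurable_EFinP; apply: measurable_funM => //; exact: measurable_truncated.
- by move=> x /half_lineP x0; rewrite lee_fin mulr_ge0 ?mq0.
- by apply/measurable_EFinP; apply: measurable_funM.
apply: eq_integral => x; rewrite inE => /half_lineP x0; rewrite -EFinD; congr EFin.
rewrite [qpoch _ _ n.+2]qpochSl [in qpoch (- (q * x)) q n.+1]mulrC -mulNr.
rewrite [qpoch (- x * q) q n.+1]qpochSr [qpoch (- x) q n.+1]qpochSl.
rewrite !mulNr !opprK -mulrA -exprS.
have h1 : 1 + x != 0 by rewrite gt_eqF// addr_gt0.
have h2 : 1 + x * q ^+ n.+1 != 0 by rewrite gt_eqF// addr_gt0// mulr_gt0// exprn_gt0.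
have h3 : qpoch (- (x * q)) q n != 0 by rewrite gt_eqF// qpochN_gt0 ?mulr_gt0.
by field; rewrite h1 h2 h3.
Qed.

(** The integral of [x^alpha / (-x; q)_(n+1)] converges for [-1 < alpha < 0]
    already when [n = 0], where it is the beta integral. *)
Lemma truncated_momentE n alpha : -1 < alpha < 0 ->
  truncated_moment n.+1 alpha =
  (Euler_integral (- alpha) * Euler_integral (alpha + 1) *
   (qpoch (q `^ (- alpha)) q n / qpoch q q n))%:E.
Proof.
move=> a10; elim: n => [|n IHn].
  rewrite !qpoch0 divff ?oner_neq0// mulr1 -integral_beta//.
  apply: eq_integral => x _; congr (_ / _)%:E.
  by rewrite qpochSr qpoch0 mul1r mulr1 opprK.
have := truncated_moment_rec n alpha; rewrite IHn.
have : (0 <= truncated_moment n.+2 alpha)%E.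
  by apply: integral_ge0 => x /half_lineP x0; rewrite lee_fin truncated_ge0.
have qn : 0 < 1 - q ^+ n.+1 by rewrite subr_gt0 exprn_ilt1 ?(ltW q0).
have Q k : qpoch q q k != 0 by exact: qpoch_neq0.
have p0 : q `^ (alpha + 1) != 0 by rewrite gt_eqF ?powR_gt0.
case: (truncated_moment n.+2 alpha) => [r _|_|//]; last first.
  by rewrite mulry gtr0_sg// mul1e addye// => -[].
rewrite -!EFinM -EFinD => -[e]; congr EFin.
apply: (mulfI (lt0r_neq0 qn)); rewrite [qpoch _ _ n.+1]qpochSr [qpoch q _ n.+1]qpochSr -exprS.
apply: (addIr (q ^+ n.+1 / q `^ (alpha + 1) *
  (Euler_integral (- alpha) * Euler_integral (alpha + 1) *
   (qpoch (q `^ (- alpha)) q n / qpoch q q n)))).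
rewrite -e powRN; have -> : q `^ (alpha + 1) = q `^ alpha * q.
  by rewrite powRD ?(gt_eqF q0) ?implybT// powRr1// ltW.
rewrite exprS; field.
by rewrite Q !gt_eqF ?powR_gt0// -exprS.
Qed.

(** The truncated densities decrease to [1 / (-x; q)_oo], dominated by the first
    of them. *)
Lemma weight1_moment alpha : -1 < alpha < 0 ->
  density_moment (weight1 q) alpha =
  (Euler_integral (- alpha) * Euler_integral (alpha + 1) *
   (qpoch_inf (q `^ (- alpha)) q / qpoch_inf q q))%:E.
Proof.
move=> a10.
have cI : truncated_moment n.+1 alpha @[n --> \oo] --> density_moment (weight1 q) alpha.
  have := @dominated_cvg _ _ _ leb D (measurable_itv _)
    (fun n x => (x `^ alpha / qpoch (- x) q n.+1)%:E)
    (fun x => (x `^ alpha * weight1 q x)%:E)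
    (fun x => (x `^ alpha / qpoch (- x) q 1)%:E).
  apply.
  - by move=> n; apply/measurable_EFinP; exact: measurable_truncated.
  - move=> x /half_lineP x0; apply: cvg_EFin; first exact: nearW.
    apply: cvgM; first exact: cvg_cst.
    apply: cvgV; first by rewrite gt_eqF// (lt_le_trans ltr01)// qpoch_inf_ge1// oppr_le0 ltW.
    rewrite (cvg_shiftS (qpoch (- x) q)).
    exact: cvg_qpoch.
  - by [].
  - apply/integrableP; split.
      by apply/measurable_EFinP; exact: measurable_truncated.
    have : (truncated_moment 1 alpha < +oo)%E by rewrite truncated_momentE// ltry.
    apply: le_lt_trans; rewrite le_eqVlt; apply/orP; left; apply/eqP.
    apply: eq_integral => x; rewrite inE => /half_lineP x0.
    by rewrite gee0_abs// lee_fin truncated_ge0.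
  - move=> n x /half_lineP x0.
    rewrite gee0_abs ?lee_fin ?truncated_ge0// ler_wpM2l ?powR_ge0//.
    rewrite lef_pV2 ?posrE ?qpochN_gt0//.
    rewrite -[n.+1]add1n qpochD ler_peMr ?(ltW (qpochN_gt0 _ x0))//.
    by rewrite qpoch_ge1// expr1 mulNr oppr_le0 mulr_ge0 ?ltW.
apply/esym; move: cI; rewrite (_ : (fun n => truncated_moment n.+1 alpha) = fun n =>
    (Euler_integral (- alpha) * Euler_integral (alpha + 1) *
     (qpoch (q `^ (- alpha)) q n / qpoch q q n))%:E); last first.
  by apply/funext => n; exact: truncated_momentE.
move=> cI; rewrite -(cvg_lim _ cI)//; apply/esym/cvg_lim => //.
apply: cvg_EFin; first exact: nearW.
apply: cvgM; first exact: cvg_cst.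
apply: cvgM; first exact: cvg_qpoch.
by apply: cvgV; [exact: qpoch_inf_neq0|exact: cvg_qpoch].
Qed.

End weight1.

(** * Ramanujan's q-beta integral *)

Section ramanujan_q_beta.
Context {R : realType}.
Local Notation leb := (@lebesgue_measure R).
Local Notation D := (`]0%R, +oo[%classic : set (measurableTypeR R)).
Implicit Types (s t x alpha : R).

Lemma Gamma_gt0E x : 0 < x -> Gamma x = Euler_integral x.
Proof.
move=> x0; rewrite /Gamma.
have -> : Num.truncn (1 - x) = 0%N.
  by apply/truncn0Pn; rewrite -ltNge gtrBl.
by rewrite big_ord0 divr1 addr0.
Qed.

(** The shift needed to make the argument positive grows by one when the
    argument decreases by one, and the new factor is the argument itself. *)
Lemma GammaN_rec alpha : -1 < alpha ->
  Gamma (- alpha) = - (alpha + 1) * Gamma (- (alpha + 1)).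
Proof.
move=> a1; have a10 : 0 <= 1 + alpha by lra.
rewrite /Gamma !opprK.
have -> : Num.truncn (1 + (alpha + 1)) = (Num.truncn (1 + alpha)).+1.
  have /andP[h1 h2] := truncn_itv a10.
  apply/eqP; rewrite truncn_eq; last by lra.
  by rewrite -!natr1 in h2 *; apply/andP; split; lra.
set N := Num.truncn _; rewrite big_ord_recl addr0.
have e : - (alpha + 1) + N.+1%:R = - alpha + N%:R by rewrite -natr1; ring.
rewrite e; have -> : \prod_(i < N) (- (alpha + 1) + (lift ord0 i)%:R) =
    \prod_(i < N) (- alpha + i%:R).
  by apply: eq_bigr => i _; rewrite lift0 -natr1; ring.
rewrite invfM mulrCA mulVKf// oppr_eq0 gt_eqF//; lra.
Qed.

Variable q : R.
Hypothesis q01 : 0 < q < 1.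
Let q0 : 0 < q. Proof. by case/andP: q01. Qed.

Definition moment1 s := fine (density_moment (weight1 q) s).

Lemma moment1_fin_small s : -1 < s < 0 -> (density_moment (weight1 q) s < +oo)%E.
Proof. by move=> s10; rewrite weight1_moment// ltry. Qed.

Lemma moment1_rec s : -1 < s -> moment1 (s + 1) = ((q `^ (s + 1))^-1 - 1) * moment1 s.
Proof.
exact: (density_moment_rec q01 (measurable_weight1 q01) (weight1_ge0 q01)
  (weight1_scale q01) moment1_fin_small).
Qed.

Lemma moment1_fin s : -1 < s -> (density_moment (weight1 q) s < +oo)%E.
Proof.
exact: (density_moment_fin q01 (measurable_weight1 q01) (weight1_ge0 q01)
  (weight1_scale q01) moment1_fin_small).
Qed.

(** Both sides satisfy the same recurrence in [alpha], which reduces to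
    [-1 < alpha < 0]. *)
Lemma moment1E alpha : -1 < alpha -> alpha \isn't a Num.nat ->
  moment1 alpha = Gamma (- alpha) * Gamma (alpha + 1) *
    (qpoch_inf (q `^ (- alpha)) q / qpoch_inf q q).
Proof.
move=> a1; have base a : -1 < a < 0 -> moment1 a = Gamma (- a) * Gamma (a + 1) *
    (qpoch_inf (q `^ (- a)) q / qpoch_inf q q).
  move=> a10; have /andP[h1 h2] := a10; rewrite /moment1 weight1_moment//= (@Gamma_gt0E (- a)); last lra.
  by rewrite Gamma_gt0E// -ltrBlDr sub0r.
have [k] : exists k, alpha < k%:R.
  by exists (Num.truncn alpha).+1; exact: truncnS_gt.
elim: k alpha a1 => [|k IHk] alpha a1 ak anat; first by apply: base; rewrite a1.
have [a0|a0|a0] := ltgtP alpha 0; first by apply: base; rewrite a1.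
- set b := alpha - 1; have ab : alpha = b + 1 by rewrite subrK.
  have b1 : -1 < b by rewrite /b; lra.
  have bnat : b \isn't a Num.nat.
    by apply: contra anat; rewrite ab => bn; rewrite rpredD ?rpred1.
  rewrite ab moment1_rec// IHk//; last by rewrite /b ltrBlDr natr1.
  rewrite (GammaN_rec b1) [Gamma (b + 1 + 1)]Gamma_gt0E; last by lra.
  rewrite Euler_integralS; last by lra.
  rewrite [Gamma (b + 1)]Gamma_gt0E; last by lra.
  rewrite (qpoch_infS q01 (q `^ (- (b + 1)))).
  have -> : q `^ (- (b + 1)) * q = q `^ (- b).
    rewrite -{2}(powRr1 (ltW q0)) -powRD ?(gt_eqF q0) ?implybT//.
    by congr powR; ring.
  by rewrite (powRN q (b + 1)); ring.
- by move: anat; rewrite a0 rpred0.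
Qed.

Lemma measurable_moment1 s :
  measurable_fun D (fun x : measurableTypeR R => x `^ s * weight1 q x).
Proof. by apply: measurable_moment; exact: measurable_weight1. Qed.

Lemma integrable_moment1 s : -1 < s ->
  leb.-integrable D (fun x => (x `^ s * weight1 q x)%:E).
Proof.
move=> s1; apply/integrableP; split.
  by apply/measurable_EFinP; exact: measurable_moment1.
apply: le_lt_trans (moment1_fin s1).
rewrite le_eqVlt; apply/orP; left; apply/eqP.
apply: eq_integral => x; rewrite inE => /half_lineP x0.
by rewrite gee0_abs// lee_fin (moment_ge0 (weight1_ge0 q01)).
Qed.

Lemma continuous_powR_exponent x : 0 < x -> continuous (fun s : R => x `^ s).
Proof.
move=> x0 s; rewrite /powR gt_eqF//.
apply: (@continuous_comp _ _ _ (fun s => s * ln x) expR); last exact: continuous_expR.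
by apply: cvgM; [exact: cvg_id|exact: cvg_cst].
Qed.

Lemma continuous_moment1 alpha : 0 <= alpha -> {for alpha, continuous moment1}.
Proof.
move=> a0.
have h := @continuity_under_integral R _ _ leb (fun s x => x `^ s * weight1 q x) D
  (measurable_itv _) (alpha - 2^-1) (alpha + 2^-1).
apply: (h _ _ (fun x => x `^ (alpha - 2^-1) * weight1 q x +
    x `^ (alpha + 2^-1) * weight1 q x)).
- move=> s; rewrite /= in_itv/= => /andP[s1 _]; apply: integrable_moment1; lra.
- apply: aeW => x /half_lineP x0 s _; apply: cvgM; last exact: cvg_cst.
  exact: continuous_powR_exponent.
- apply: (eq_integrable _ _ _ _ (integrableD _ (@integrable_moment1 (alpha - 2^-1) _)
    (@integrable_moment1 (alpha + 2^-1) _))) => //; lra.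
- move=> s; rewrite /= in_itv/= => /andP[s1 s2]; apply: aeW => x /half_lineP x0.
  rewrite ger0_norm ?(moment_ge0 (weight1_ge0 q01))// -mulrDl.
  by rewrite ler_wpM2r ?(weight1_ge0 q01)// powR_interp// !ltW.
- by rewrite inE/= in_itv/=; apply/andP; split; lra.
Qed.

Lemma zeta1_formulaE n alpha : -1 < alpha -> alpha \isn't a Num.nat ->
  zeta1_formula q n alpha =
  moment1 alpha * (qpoch (q `^ (alpha + 1)) q n / (q ^+ n * qpoch q q n)).
Proof. by move=> a1 anat; rewrite /zeta1_formula moment1E. Qed.

(** At a natural number [Gamma(-alpha)] has a pole and [(q^(-alpha); q)_oo] a
    zero.  The formula equals a continuous function of [alpha] around it, whose
    value is therefore the limit. *)
Lemma zeta1E n alpha : -1 < alpha ->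
  zeta1 q n alpha =
  moment1 alpha * (qpoch (q `^ (alpha + 1)) q n / (q ^+ n * qpoch q q n)).
Proof.
move=> a1; rewrite /zeta1; case: ifPn => [anat|]; last exact: zeta1_formulaE.
apply/cvg_lim => //.
have a0 : 0 <= alpha by exact: natr_ge0.
have cvg_formula : moment1 a * (qpoch (q `^ (a + 1)) q n / (q ^+ n * qpoch q q n))
    @[a --> alpha] -->
    moment1 alpha * (qpoch (q `^ (alpha + 1)) q n / (q ^+ n * qpoch q q n)).
  apply: cvgM; first exact: continuous_moment1.
  apply: cvgM; last exact: cvg_cst.
  elim: n => [|n IHn].
    by under eq_fun do rewrite qpoch0; rewrite qpoch0; exact: cvg_cst.
  under eq_fun do rewrite qpochSr; rewrite qpochSr.
  apply: cvgM => //; apply: cvgB; first exact: cvg_cst.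
  apply: cvgM; last exact: cvg_cst.
  apply: (@continuous_comp _ _ _ (fun s => s + 1) (fun s => q `^ s)).
    by apply: cvgD; [exact: cvg_id|exact: cvg_cst].
  exact: continuous_powR_exponent.
have cvg_punctured : moment1 a * (qpoch (q `^ (a + 1)) q n / (q ^+ n * qpoch q q n))
    @[a --> alpha^'] -->
    moment1 alpha * (qpoch (q `^ (alpha + 1)) q n / (q ^+ n * qpoch q q n)).
  by apply: cvg_within_filter; exact: cvg_formula.
apply: cvg_trans cvg_punctured; apply: near_eq_cvg.
have h a : ball alpha 1 a -> a != alpha ->
    moment1 a * (qpoch (q `^ (a + 1)) q n / (q ^+ n * qpoch q q n)) =
    zeta1_formula q n a.
  rewrite /ball/= ltr_distl => /andP[h1 h2] neq.
  rewrite zeta1_formulaE//; first lra.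
  apply: contra neq => /natrP[k ak]; have /natrP[l al] := anat.
  rewrite ak al eqr_nat.
  move: h1 h2; rewrite ak al ltrBlDr natr1 natr1 !ltr_nat => h1 h2.
  by rewrite eqn_leq; apply/andP; split; rewrite -ltnS.
by apply/nbhs_ballP; exists 1 => //= a ab neq; exact: h.
Qed.

End ramanujan_q_beta.

(** * The theta quotient weight *)

Section theta_weight_moments.
Context {R : realType}.
Local Notation leb := (@lebesgue_measure R).
Local Notation D := (`]0%R, +oo[%classic : set (measurableTypeR R)).
Implicit Types (s t x : R).
Variables q c lambda : R.
Hypotheses (q01 : 0 < q < 1) (lambda0 : 0 < lambda).
Let q0 : 0 < q. Proof. by case/andP: q01. Qed.
Let q1 : q < 1. Proof. by case/andP: q01. Qed.

Definition theta (a x : R) : R :=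
  qpoch_inf (- (a * x)) q * qpoch_inf (- (q / (a * x))) q.

(** The rescaling moves the factor [1 + a x] out of the first product and
    [1 + 1/(a x)] into the second. *)
Lemma theta_scale a x : 0 < a -> 0 < x -> a * x * theta a (q * x) = theta a x.
Proof.
move=> a0 x0; rewrite /theta.
have ax : a * x != 0 by rewrite gt_eqF// mulr_gt0.
rewrite (qpoch_infS q01 (- (a * x))) (qpoch_infS q01 (- (q / (a * (q * x))))).
have -> : - (q / (a * (q * x))) * q = - (q / (a * x)).
  by field; rewrite !gt_eqF.
have -> : - (a * (q * x)) = - (a * x) * q by ring.
have -> : 1 - - (q / (a * (q * x))) = (1 + a * x) / (a * x).
  by field; rewrite !gt_eqF.
by rewrite opprK; field; rewrite !gt_eqF.
Qed.

Lemma theta_ge1 a x : 0 < a -> 0 < x -> 1 <= theta a x.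
Proof.
move=> a0 x0; rewrite -[leLHS]mulr1 /theta ler_pM// qpoch_inf_ge1// oppr_le0.
  by rewrite mulr_ge0 ?ltW.
by rewrite divr_ge0 ?mulr_ge0 ?ltW.
Qed.

Lemma theta_gt0 a x : 0 < a -> 0 < x -> 0 < theta a x.
Proof. by move=> a0 x0; rewrite (lt_le_trans ltr01)// theta_ge1. Qed.

Let l' := lambda * q `^ c.
Let l'0 : 0 < l'. Proof. by rewrite mulr_gt0// powR_gt0. Qed.

Definition theta_ratio x := x `^ (- c) * theta lambda x / theta l' x.

Lemma theta_quotientE e x :
  theta_quotient q c lambda e x = x `^ e * (theta lambda x / theta l' x) * weight1 q x.
Proof.
rewrite /theta_quotient /qpochs_inf !big_cons !big_nil !mulr1 /theta /weight1 -/l'.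
by rewrite [RHS]mulrAC !invfM; ring.
Qed.

Lemma weight3E x : weight3 q c lambda x = theta_ratio x * weight1 q x.
Proof. by rewrite /weight3 theta_quotientE /theta_ratio mulrA. Qed.

(** Rescaling by [q] divides the two theta products by [lambda x] and
    [lambda q^c x] and multiplies [x^(-c)] by [q^(-c)], which cancel. *)
Lemma theta_ratio_scale x : 0 < x -> theta_ratio (q * x) = theta_ratio x.
Proof.
move=> x0; rewrite /theta_ratio -(theta_scale lambda0 x0) -(theta_scale l'0 x0).
have qx : 0 < q * x by rewrite mulr_gt0.
have := theta_gt0 l'0 qx; move: (theta _ _) (theta _ _) => t2 t1 t0.
rewrite powRM ?ltW// /l' powRN; field.
by rewrite !gt_eqF ?powR_gt0.
Qed.

Lemma weight3_scale x : 0 < x -> weight3 q c lambda (q * x) = (1 + x) * weight3 q c lambda x.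
Proof.
by move=> x0; rewrite !weight3E theta_ratio_scale// weight1_scale// mulrCA.
Qed.

Lemma theta_ratio_ge0 x : 0 < x -> 0 <= theta_ratio x.
Proof.
move=> x0; rewrite /theta_ratio.
apply: divr_ge0; last exact: ltW (theta_gt0 l'0 x0).
by apply: mulr_ge0; [exact: powR_ge0|exact: ltW (theta_gt0 lambda0 x0)].
Qed.

(** Being [q]-periodic in the multiplicative sense, [theta_ratio] only takes the
    values that it takes on [[q, 1]]. *)
Lemma theta_ratio_bounded : exists K, forall x, 0 < x -> theta_ratio x <= K.
Proof.
pose K1 := (q `^ (- c) + 1) *
  (qpoch_inf (- (lambda * 1)) q * qpoch_inf (- (q / (lambda * q))) q).
have base x : q <= x <= 1 -> theta_ratio x <= K1.
  move=> /andP[qx x1]; have x0 : 0 < x by exact: lt_le_trans qx.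
  have t1 : (theta l' x)^-1 <= 1 by rewrite invf_le1 ?theta_gt0// theta_ge1.
  have t2 : theta lambda x <= qpoch_inf (- (lambda * 1)) q * qpoch_inf (- (q / (lambda * q))) q.
    rewrite /theta ler_pM//.
    - by rewrite qpoch_inf_ge0// oppr_le0 mulr_ge0 ?ltW.
    - by rewrite qpoch_inf_ge0// oppr_le0 divr_ge0 ?mulr_ge0 ?ltW.
    - apply: qpoch_inf_anti => //; first by rewrite lerN2 ler_pM2l.
      by rewrite oppr_le0 mulr_ge0 ?ltW.
    - apply: qpoch_inf_anti => //.
        by rewrite lerN2 ler_pM2l// lef_pV2 ?posrE ?mulr_gt0// ler_pM2l.
      by rewrite oppr_le0 divr_ge0 ?mulr_ge0 ?ltW.
  have t3 : x `^ (- c) <= q `^ (- c) + 1.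
    have [c0|c0] := leP 0 (- c).
      apply: ler_wpDl; first exact: powR_ge0.
      rewrite (le_trans (ge0_ler_powR c0 _ _ x1)) ?nnegrE ?(ltW x0)//.
      by rewrite powR1.
    apply: ler_wpDr => //.
    have c0' : 0 <= c by lra.
    rewrite !powRN lef_pV2 ?posrE ?powR_gt0//.
    by rewrite ge0_ler_powR ?nnegrE ?(ltW x0) ?(ltW q0).
  rewrite /theta_ratio -[leRHS]mulr1; apply: ler_pM => //.
  - by apply: mulr_ge0; [exact: powR_ge0|exact: ltW (theta_gt0 lambda0 x0)].
  - by rewrite invr_ge0 (ltW (theta_gt0 l'0 x0)).
  - apply: ler_pM => //; first exact: powR_ge0.
    exact: ltW (theta_gt0 lambda0 x0).
have step n x : q ^+ n.+1 <= x <= q ^- n -> theta_ratio x <= K1.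
  elim: n x => [|n IHn] x; first by rewrite invr1; exact: base.
  move=> /andP[xl xr].
  have x0 : 0 < x by rewrite (lt_le_trans _ xl)// exprn_gt0.
  have qn m : 0 < q ^+ m by rewrite exprn_gt0.
  have qle m p : (m <= p)%N -> q ^+ p <= q ^+ m by move=> mp; rewrite ler_wiXn2l ?(ltW q0) ?(ltW q1).
  have inv1 m : 1 <= q ^- m by rewrite invf_ge1// exprn_ile1 ?(ltW q0) ?(ltW q1).
  have [xs|xs] := ltP x (q ^+ n.+1).
    rewrite -(divfK (lt0r_neq0 q0) x) mulrC theta_ratio_scale ?divr_gt0//.
    apply: IHn; rewrite ler_pdivlMr// -exprSr xl/= ler_pdivrMr//.
    apply: le_trans (ltW xs) _; apply: le_trans (qle 1%N _ _) _ => //.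
    by rewrite expr1 ler_peMl// ltW.
  have [xb|xb] := ltP (q ^- n) x; last by apply: IHn; rewrite xs.
  rewrite -theta_ratio_scale//; apply: IHn; apply/andP; split.
    rewrite exprS ler_pM2l// (le_trans _ (ltW xb))//.
    by apply: le_trans (qle 0%N _ _) _ => //; rewrite expr0.
  rewrite mulrC -ler_pdivlMr// (le_trans xr)// -invfM -exprSr lexx//.
exists K1 => x x0.
have [n1 h1] := exists_expr_lt q01 x0.
have [|n2 h2] := @exists_expr_lt _ q q01 x^-1; first by rewrite invr_gt0.
apply: (step (n1 + n2)%N).
have qle m p : (m <= p)%N -> q ^+ p <= q ^+ m by move=> mp; rewrite ler_wiXn2l ?(ltW q0) ?(ltW q1).
rewrite (le_trans (qle n1 _ _)) ?(ltW h1)//=; last by lia.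
rewrite -[leLHS]invrK lef_pV2 ?posrE ?invr_gt0 ?exprn_gt0//.
by rewrite (le_trans _ (ltW h2))// qle// leq_addl.
Qed.

Lemma moment3_fin_small s : -1 < s < 0 ->
  (density_moment (weight3 q c lambda) s < +oo)%E.
Proof.
move=> s10; have [K hK] := theta_ratio_bounded.
have K0 : 0 <= K by rewrite (le_trans (theta_ratio_ge0 ltr01))// hK.
apply: (@le_lt_trans _ _ (\int[leb]_(x in D) (K * (x `^ s * weight1 q x))%:E)%E).
  apply: ge0_le_integral => //.
  - by move=> x /half_lineP x0; rewrite lee_fin (moment_ge0 (weight3_ge0 c q01 lambda0)).
  - by apply/measurable_EFinP; apply: measurable_moment; exact: measurable_weight3.
  - by apply/measurable_EFinP; apply: measurable_funM => //; exact: measurable_moment1.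
  - move=> x /half_lineP x0; rewrite lee_fin weight3E mulrCA ler_wpM2r ?hK//.
    exact: (moment_ge0 (weight1_ge0 q01)).
rewrite (ge0_integralZl_fin (measurable_itv _) (measurable_moment1 q01 s) _ K0).
  by move: (moment1_fin_small q01 s10); exact: lte_mul_pinfty.
by move=> x /half_lineP x0; rewrite (moment_ge0 (weight1_ge0 q01)).
Qed.

Definition moment3 s := fine (density_moment (weight3 q c lambda) s).

Lemma zeta3E n alpha : zeta3 q c lambda n alpha =
  moment3 alpha * (qpoch (q `^ (alpha + 1)) q n / (q ^+ n * qpoch q q n)).
Proof.
rewrite /zeta3 mulrC; congr (_ * _); congr fine.
apply: eq_integral => x; rewrite inE => /half_lineP x0; congr EFin.
rewrite /weight3 !theta_quotientE powRD ?(gt_eqF x0) ?implybT//.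
by rewrite !mulrA.
Qed.

End theta_weight_moments.

(** * The q-binomial series *)

Section q_binomial_series.
Context {R : realType}.
Variable q : R.
Hypothesis q01 : 0 < q < 1.
Let q0 : 0 < q. Proof. by case/andP: q01. Qed.
Let q1 : q < 1. Proof. by case/andP: q01. Qed.
Variable A : R.
Hypothesis A0 : A <= 0.
Implicit Types z : R.

Definition q_binomial_term z k := qpoch A q k / qpoch q q k * z ^+ k.

Local Notation t := q_binomial_term.

Lemma q_binomial_term_ge0 z k : 0 <= z -> 0 <= t z k.
Proof.
move=> z0; rewrite /t mulr_ge0 ?exprn_ge0// divr_ge0//.
  by rewrite (le_trans ler01)// qpoch_ge1.
by rewrite ltW// qpoch_gt0.
Qed.

Lemma is_cvg_q_binomial z : 0 <= z < 1 -> cvgn (series (t z)).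
Proof.
move=> /andP[z0 z1]; have Q0 := qpoch_inf_gt0 q01 q1.
pose C := qpoch_inf A q / qpoch_inf q q.
apply: (@series_le_cvg _ _ (geometric C z)).
- by move=> n; exact: q_binomial_term_ge0.
- by move=> n; rewrite /= mulr_ge0 ?exprn_ge0// divr_ge0 ?(ltW Q0) ?qpoch_inf_ge0.
- move=> n; rewrite /t /= ler_wpM2r ?exprn_ge0//.
  apply: ler_pM; first by rewrite (le_trans ler01)// qpoch_ge1.
  + by rewrite invr_ge0 ltW// qpoch_gt0.
  + exact: qpoch_le_inf.
  + by rewrite lef_pV2 ?posrE ?qpoch_gt0// qpoch_inf_le// (ltW q0).
- by apply: is_cvg_geometric_series; rewrite ger0_norm.
Qed.

Definition q_binomial z := limn (series (t z)).
Local Notation f := q_binomial.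

(** The factor [1 - q^k] of [t_k(z) - t_k(q z)] cancels against [(q; q)_k],
    leaving a combination of the preceding terms. *)
Lemma q_binomial_rec z : 0 <= z < 1 -> (1 - z) * f z = (1 - A * z) * f (q * z).
Proof.
move=> z01; have /andP[z0 z1] := z01.
have qz01 : 0 <= q * z < 1.
  by rewrite mulr_ge0 ?mulr_ilt1 ?(ltW q0).
have cz := is_cvg_q_binomial z01; have cqz := is_cvg_q_binomial qz01.
suff : f z - f (q * z) = z * (f z - A * f (q * z)) by move=> e; lra.
have e n : series (t z) n.+1 - series (t (q * z)) n.+1 =
    z * (series (t z) n - A * series (t (q * z)) n).
  rewrite /series/= !big_mkord -sumrB big_ord_recl.
  rewrite /t !qpoch0 !expr0 subrr add0r mulr_sumr -sumrB mulr_sumr.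
  apply: eq_bigr => i _; rewrite lift0 !qpochSr -exprS exprMn !exprS.
  have h : 1 - q * q ^+ i != 0.
    by rewrite -exprS subr_eq0 gt_eqF// exprn_ilt1 ?(ltW q0).
  rewrite exprMn; field.
  by rewrite h qpoch_neq0.
have l1 : series (t z) n.+1 - series (t (q * z)) n.+1 @[n --> \oo] --> f z - f (q * z).
  by apply: cvgB; rewrite (cvg_shiftS (series _)).
rewrite -(cvg_lim _ l1)//; apply/cvg_lim => //.
under eq_fun do rewrite e.
apply: cvgM; first exact: cvg_cst.
by apply: cvgB => //; apply: cvgM => //; exact: cvg_cst.
Qed.

(** Iterating the functional equation gives
    [f(z) = (A z; q)_n / (z; q)_n f(z q^n)], and [f] tends to [1] at [0]. *)
Lemma q_binomialE z : 0 <= z < 1 -> f z = qpoch_inf (A * z) q / qpoch_inf z q.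
Proof.
move=> z01; have /andP[z0 z1] := z01.
have zq n : 0 <= z * q ^+ n < 1.
  rewrite mulr_ge0 ?exprn_ge0 ?(ltW q0)//= (le_lt_trans _ z1)//.
  by rewrite ler_piMr// exprn_ile1 ?(ltW q0) ?(ltW q1).
have fE n : f z = qpoch (A * z) q n / qpoch z q n * f (z * q ^+ n).
  elim: n => [|n ->]; first by rewrite !qpoch0 divr1 mul1r expr0 mulr1.
  have := q_binomial_rec (zq n).
  have -> : q * (z * q ^+ n) = z * q ^+ n.+1 by rewrite mulrCA exprS.
  have h : 1 - z * q ^+ n != 0 by rewrite subr_eq0 gt_eqF//; case/andP: (zq n).
  move=> e; apply: (mulfI h); rewrite mulrCA e !qpochSr; field.
  by rewrite h qpoch_neq0.
have f1 : f (z * q ^+ n) @[n --> \oo] --> (1 : R).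
  have u : 1 + q ^+ n * f z @[n --> \oo] --> (1 : R).
    rewrite -[X in _ --> X]addr0 -(mul0r (f z)).
    apply: cvgD; first exact: cvg_cst.
    by apply: cvgM; [exact: cvg_expr0|exact: cvg_cst].
  apply: (squeeze_cvgr _ (cvg_cst (1 : R)) u).
  apply: nearW => n; apply/andP; split.
    apply: limr_ge; first exact: is_cvg_q_binomial.
    exists 1%N => // m /= m1; rewrite /series/= big_mkord.
    rewrite -(prednK m1) big_ord_recl {1}/t !qpoch0 divff ?oner_neq0// mul1r expr0.
    by rewrite lerDl sumr_ge0// => i _; apply: q_binomial_term_ge0; case/andP: (zq n).
  have l : 1 + q ^+ n * series (t z) m @[m --> \oo] --> 1 + q ^+ n * f z.
    apply: cvgD; first exact: cvg_cst.
    by apply: cvgM; [exact: cvg_cst|exact: is_cvg_q_binomial].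
  rewrite -(cvg_lim _ l)//; apply: ler_lim; first exact: is_cvg_q_binomial.
    by apply/cvg_ex; eexists; exact: l.
  apply: nearW => -[|m].
    by rewrite /series/= !big_geq// mulr0 addr0 ler01.
  rewrite /series/= !big_mkord big_ord_recl [t _ ord0]/t !qpoch0 divff ?oner_neq0//.
  rewrite mul1r expr0 lerD2l mulr_sumr big_ord_recl ler_wpDl//.
    by rewrite mulr_ge0 ?exprn_ge0 ?(ltW q0)// q_binomial_term_ge0.
  apply: ler_sum => i _; rewrite lift0.
  have -> : t (z * q ^+ n) i.+1 = t z i.+1 * (q ^+ n) ^+ i.+1 by rewrite /t exprMn mulrA.
  rewrite [leRHS]mulrC.
  rewrite ler_wpM2l ?(q_binomial_term_ge0 i.+1 z0)// exprS.
  by rewrite ler_piMr ?exprn_ge0 ?exprn_ile1 ?exprn_ge0 ?exprn_ile1 ?(ltW q0) ?(ltW q1).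
have l : qpoch (A * z) q n / qpoch z q n * f (z * q ^+ n) @[n --> \oo] -->
    qpoch_inf (A * z) q / qpoch_inf z q * 1.
  apply: cvgM => //; apply: cvgM; first exact: cvg_qpoch.
  by apply: cvgV; [exact: qpoch_inf_neq0|exact: cvg_qpoch].
rewrite -[RHS]mulr1 -(cvg_lim _ l)//; apply/esym/cvg_lim => //.
by under eq_fun do rewrite -fE; exact: cvg_cst.
Qed.

Lemma cvg_q_binomial z : 0 <= z < 1 ->
  series (t z) n @[n --> \oo] --> qpoch_inf (A * z) q / qpoch_inf z q.
Proof. by move=> z01; rewrite -q_binomialE//; exact: is_cvg_q_binomial. Qed.

End q_binomial_series.

(** * Ramanujan's bilateral sum *)

Section bilateral_sum.
Context {R : realType}.
Variables q c s : R.
Hypotheses (q01 : 0 < q < 1) (c0 : 0 < c) (s1 : -1 < s).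
Let q0 : 0 < q. Proof. by case/andP: q01. Qed.
Let q1 : q < 1. Proof. by case/andP: q01. Qed.
Let z := q `^ (s + 1).
Let z01 : 0 < z < 1. Proof. by apply: powR_01; rewrite -?ltrBlDr ?sub0r. Qed.
Let z0 : 0 < z. Proof. by case/andP: z01. Qed.

(** The point [c q^(j - N)], so that the sequence in [j] exhausts the lattice
    [c q^k] as [N] grows. *)
Definition lattice N j : R := c * q ^- N * q ^+ j.

Definition lattice_term N j : R :=
  lattice N j `^ s * (lattice N j / qpoch_inf (- lattice N j) q).

Local Notation u := lattice_term.

Lemma lattice_gt0 N j : 0 < lattice N j.
Proof. by rewrite /lattice !mulr_gt0 ?invr_gt0 ?exprn_gt0. Qed.

Lemma latticeD N M j : lattice (N + M) (j + M) = lattice N j.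
Proof.
rewrite /lattice !exprD; field.
by rewrite !expf_neq0 ?gt_eqF.
Qed.

Lemma lattice_term_ge0 N j : 0 <= u N j.
Proof.
have h := lattice_gt0 N j.
rewrite /u mulr_ge0 ?powR_ge0// divr_ge0 ?(ltW h)//.
by rewrite qpoch_inf_ge0// oppr_le0 ltW.
Qed.

Lemma lattice_termD N M j : u (N + M) (j + M) = u N j.
Proof. by rewrite /u latticeD. Qed.

Let P j := qpoch_inf (q ^+ j.+1) q.

Let P01 j : 0 <= P j <= 1.
Proof.
have h : 0 <= q ^+ j.+1 < 1 by rewrite exprn_ge0 ?exprn_ilt1 ?(ltW q0).
rewrite /P ltW ?qpoch_inf_gt0//=; last by case/andP: h.
by have := qpoch_inf_le q01 0 h; rewrite qpoch0.
Qed.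

Let P_le j k : P j <= P (k + j).
Proof.
rewrite /P (qpoch_infD q01 (q ^+ j.+1) k) -exprD.
have -> : (j.+1 + k = (k + j).+1)%N by lia.
have /andP[h _] := P01 (k + j); rewrite ler_piMl//.
have : 0 <= q ^+ j.+1 <= 1.
  by rewrite exprn_ge0 ?exprn_ile1 ?(ltW q0) ?(ltW q1).
by move/(qpoch_le1 q01 k)/andP => [].
Qed.

Definition lattice_sum N : \bar R := (\sum_(j <oo) (u N j)%:E)%E.
Definition damped_sum N : \bar R := (\sum_(j <oo) (u N j * P j)%:E)%E.

Lemma lattice_sumS N : lattice_sum N.+1 = ((u N.+1 0)%:E + lattice_sum N)%E.
Proof.
rewrite /lattice_sum (nneseries_split 0 1); last by move=> k _; rewrite lee_fin lattice_term_ge0.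
rewrite add0n big_nat1; congr (_ + _)%E.
rewrite -nneseries_addn; last by move=> k; rewrite lee_fin lattice_term_ge0.
by apply: eq_eseriesr => j _; rewrite -[N.+1]addn1 lattice_termD.
Qed.

(** The factors [(q^(j+1); q)_oo] turn the sum over [j] into a q-binomial
    series: [(-b; q)_j / (q; q)_j z^j] with [b = c q^(-N)]. *)
Lemma damped_sumE N : damped_sum N =
  ((c * q ^- N) `^ (s + 1) * qpoch_inf q q / qpoch_inf (- (c * q ^- N)) q *
   (qpoch_inf (- (c * q ^- N) * z) q / qpoch_inf z q))%:E.
Proof.
set b := c * q ^- N.
have b0 : 0 < b by rewrite mulr_gt0 ?invr_gt0 ?exprn_gt0.
have bN : - b <= 0 by rewrite oppr_le0 ltW.
set K := _ / qpoch_inf (- b) q.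
have e j : u N j * P j = K * q_binomial_term q (- b) z j.
  rewrite /u /lattice -/b /P /q_binomial_term.
  have bq : 0 < b * q ^+ j by rewrite mulr_gt0 ?exprn_gt0.
  rewrite mulrA -{2}(powRr1 (ltW bq)) -powRD ?(gt_eqF bq) ?implybT//.
  rewrite powRM ?(ltW b0) ?exprn_ge0 ?(ltW q0)//.
  have -> : (q ^+ j) `^ (s + 1) = z ^+ j.
    by rewrite -(powR_mulrn j (ltW q0)) -(powR_mulrn j (ltW z0)) -!powRrM mulrC.
  rewrite /K (qpoch_infD q01 (- b) j) (qpoch_infD q01 q j) -exprS mulNr.
  have h1 : qpoch (- b) q j != 0 by rewrite gt_eqF// (lt_le_trans ltr01)// qpoch_ge1.
  have h2 : qpoch_inf (- (b * q ^+ j)) q != 0.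
    by rewrite qpoch_inf_neq0// (le_lt_trans _ ltr01)// oppr_le0 ltW.
  by field; rewrite h1 h2 qpoch_neq0.
rewrite /damped_sum; apply/cvg_lim => //.
have -> : (fun n => \sum_(0 <= j < n) (u N j * P j)%:E)%E =
    (fun n => (K * series (q_binomial_term q (- b) z) n)%:E).
  apply/funext => n; rewrite sumEFin /series/= mulr_sumr; congr EFin.
  by apply: eq_bigr => j _; exact: e.
apply: cvg_EFin; first exact: nearW.
apply: cvgM; first exact: cvg_cst.
by apply: cvg_q_binomial => //; rewrite (ltW z0); case/andP: z01.
Qed.

(** The limit of the damped sums: [b = c q^(-N)] contributes [N] more factors to
    each of the two products [(-b; q)_oo] and [(-b z; q)_oo]; up to monomials in
    [q], [c] and [z], these factors are [(-q/c; q)_N] and [(-q/(c z); q)_N]. *)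
Definition ramanujan_sum : R :=
  c `^ (s + 1) * qpoch_inf q q / qpoch_inf (- c) q *
  (qpoch_inf (- c * z) q / qpoch_inf z q) *
  (qpoch_inf (- (q / (c * z))) q / qpoch_inf (- (q / c)) q).

Lemma damped_sum_qpoch N : damped_sum N =
  (c `^ (s + 1) * qpoch_inf q q / qpoch_inf (- c) q *
   (qpoch_inf (- c * z) q / qpoch_inf z q) *
   (qpoch (- (q / (c * z))) q N / qpoch (- (q / c)) q N))%:E.
Proof.
rewrite damped_sumE; congr EFin.
elim: N => [|N IHN].
  by rewrite !qpoch0 expr0 invr1 !mulr1.
rewrite !qpochSr; set b := c * q ^- N in IHN.
have b0 : 0 < b by rewrite mulr_gt0 ?invr_gt0 ?exprn_gt0.
have -> : c * q ^- N.+1 = b / q by rewrite exprSr invfM mulrA.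
rewrite (qpoch_infS q01 (- (b / q))) (qpoch_infS q01 (- (b / q) * z)).
have -> : - (b / q) * q = - b by rewrite mulNr divfK ?gt_eqF.
have -> : - (b / q) * z * q = - b * z by field; rewrite gt_eqF.
have -> : (b / q) `^ (s + 1) = b `^ (s + 1) / z.
  by rewrite powRM ?invr_ge0 ?(ltW b0) ?(ltW q0)// -powR_inv1 ?(ltW q0)// -powRrM
    mulN1r powRN.
transitivity (b `^ (s + 1) * qpoch_inf q q / qpoch_inf (- b) q *
     (qpoch_inf (- b * z) q / qpoch_inf z q) *
     ((1 + q / (c * z) * q ^+ N) / (1 + q / c * q ^+ N))).
  have h1 : qpoch_inf (- b) q != 0.
    by rewrite qpoch_inf_neq0// (le_lt_trans _ ltr01)// oppr_le0 ltW.
  have h2 : qpoch_inf z q != 0 by rewrite qpoch_inf_neq0//; case/andP: z01.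
  have -> : q / (c * z) * q ^+ N = q / (b * z).
    by rewrite /b; field; rewrite !gt_eqF ?exprn_gt0.
  have -> : q / c * q ^+ N = q / b.
    by rewrite /b; field; rewrite !gt_eqF ?exprn_gt0.
  have bq : 0 < b + q by rewrite addr_gt0.
  have bq' : 0 < q + b by rewrite addr_gt0.
  by field; rewrite h1 h2 !gt_eqF.
rewrite IHN.
have h3 : 1 + q / c * q ^+ N != 0.
  by rewrite gt_eqF// addr_gt0// mulr_gt0 ?exprn_gt0// divr_gt0.
have h4 : qpoch (- (q / c)) q N != 0.
  by rewrite gt_eqF// (lt_le_trans ltr01)// qpoch_ge1// oppr_le0 divr_ge0// ltW.
rewrite -!mulrA; do 5 congr (_ * _); rewrite !mulrA.
by rewrite !mulNr !opprK !invfM; ring.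
Qed.

Lemma cvg_damped_sum : damped_sum N @[N --> \oo] --> ramanujan_sum%:E.
Proof.
under eq_fun do rewrite damped_sum_qpoch.
apply: cvg_EFin; first exact: nearW.
apply: cvgM; first exact: cvg_cst.
apply: cvgM; first exact: cvg_qpoch.
apply: cvgV; last exact: cvg_qpoch.
rewrite qpoch_inf_neq0// (le_lt_trans _ ltr01)// oppr_le0 divr_ge0// ltW//.
Qed.

Lemma damped_sum_le N : (damped_sum N <= lattice_sum N)%E.
Proof.
apply: lee_nneseries => [j _ _|j _]; rewrite lee_fin.
  by rewrite mulr_ge0 ?lattice_term_ge0//; case/andP: (P01 j).
by rewrite ler_piMr ?lattice_term_ge0//; case/andP: (P01 j).
Qed.

(** Only the terms of index at least [N] are kept on the right; there the
    damping is at least [(q^(N+1); q)_oo]. *)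
Lemma lattice_sum_le N : ((P N)%:E * lattice_sum N <= damped_sum (N + N))%E.
Proof.
have uP0 k j : 0 <= u k j * P j.
  by rewrite mulr_ge0 ?lattice_term_ge0//; case/andP: (P01 j).
rewrite -nneseriesZl; last by move=> j _; rewrite lee_fin lattice_term_ge0.
rewrite /damped_sum [leRHS](nneseries_split 0 N); last by move=> k _; rewrite lee_fin uP0.
rewrite add0n -[leLHS]add0e; apply: leeD.
  by rewrite sume_ge0// => j _; rewrite lee_fin uP0.
rewrite -[leRHS]nneseries_addn; last by move=> k; rewrite lee_fin uP0.
apply: lee_nneseries => [j _ _|j _].
  by rewrite -EFinM lee_fin mulr_ge0 ?lattice_term_ge0//; case/andP: (P01 N).
by rewrite lattice_termD -EFinM lee_fin mulrC ler_wpM2l ?lattice_term_ge0 ?P_le.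
Qed.

(** The lattice sum lies between the damped sums of index [N] and, divided by
    [(q^(N+1); q)_oo], which tends to [1], of index [2 N]. *)
Lemma cvg_lattice_sum : lattice_sum N @[N --> \oo] --> ramanujan_sum%:E.
Proof.
have P0 N : 0 < P N.
  by rewrite qpoch_inf_gt0// exprn_ilt1 ?(ltW q0).
have h : ((P N)^-1%:E * damped_sum (N + N))%E @[N --> \oo] --> ramanujan_sum%:E.
  rewrite -(mul1e ramanujan_sum%:E).
  apply: cvgeM; first by [].
    apply: cvg_EFin; first exact: nearW.
    rewrite -[X in _ --> X]invr1; apply: cvgV; first exact: oner_neq0.
    exact: qpoch_inf_expr_cvg1.
  have : (fun N => (N + N)%N) n @[n --> \oo] --> \oo.
    move=> A [M _ MA]; exists M => // n /= Mn; apply: MA => /=.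
    exact: leq_trans Mn (leq_addr _ _).
  by move/cvg_comp; apply; exact: cvg_damped_sum.
apply: (squeeze_cvge _ cvg_damped_sum h); apply: nearW => N.
rewrite damped_sum_le/=.
have -> : lattice_sum N = ((P N)^-1%:E * ((P N)%:E * lattice_sum N))%E.
  by rewrite muleA -EFinM mulVf ?gt_eqF// mul1e.
by rewrite lee_wpmul2l ?lattice_sum_le// lee_fin invr_ge0 ltW.
Qed.

(** The two series run over the exponents [k >= 0] and [k < 0]. *)
Lemma bilateral_sumE :
  (\sum_(n <oo) (u 0 n)%:E + \sum_(n <oo) (u n.+1 0)%:E = ramanujan_sum%:E)%E.
Proof.
have e N : lattice_sum N = (\sum_(n <oo) (u 0 n)%:E + \sum_(0 <= n < N) (u n.+1 0)%:E)%E.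
  elim: N => [|N IHN]; first by rewrite big_nil adde0.
  by rewrite lattice_sumS IHN big_nat_recr//= addeCA [X in (_ + X)%E]addeC.
rewrite -(cvg_lim _ cvg_lattice_sum)//; apply/esym/cvg_lim => //.
under eq_fun do rewrite e.
apply: cvgeD; last 2 first.
- exact: cvg_cst.
- by apply: is_cvg_nneseries => n _ _; rewrite lee_fin lattice_term_ge0.
by apply: ge0_adde_def; rewrite inE nneseries_ge0// => n _ _; rewrite lee_fin lattice_term_ge0.
Qed.

End bilateral_sum.

(** * The discrete weight *)

Section discrete_moments.
Context {R : realType}.
Local Notation D := (`]0%R, +oo[%classic : set (measurableTypeR R)).
Variables q c : R.
Hypotheses (q01 : 0 < q < 1) (c0 : 0 < c).
Let q0 : 0 < q. Proof. by case/andP: q01. Qed.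
Implicit Types (s alpha : R).

Lemma integral_atom2 s k :
  (\int[atom2 q01 c0 k]_(x in D) (x `^ s)%:E =
   ((c * q ^ k) `^ s * mass2 q c k)%:E)%E.
Proof.
have x0 : 0 < c * q ^ k by rewrite mulr_gt0// exprz_gt0.
have mp : measurable_fun D (fun x : measurableTypeR R => (x `^ s)%:E).
  by apply/measurable_EFinP; exact: measurable_pow.
rewrite ge0_integral_mscale//; last by move=> x _; rewrite lee_fin powR_ge0.
rewrite integral_dirac// diracE mem_set; last by rewrite /= in_itv/= andbT.
by rewrite mul1e -EFinM mulrC.
Qed.

Lemma integral_mu2 s : -1 < s ->
  (\int[mu2 q01 c0]_(x in D) (x `^ s)%:E = (ramanujan_sum q c s)%:E)%E.
Proof.
move=> s1; have mp : measurable_fun D (fun x : measurableTypeR R => (x `^ s)%:E).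
  by apply/measurable_EFinP; exact: measurable_pow.
have p0 (x : measurableTypeR R) : D x -> (0 <= (x `^ s)%:E)%E.
  by move=> _; rewrite lee_fin powR_ge0.
rewrite ge0_integral_measure_add// !ge0_integral_measure_series//.
rewrite -(bilateral_sumE q01 c0 s1); congr (_ + _)%E.
- apply: eq_eseriesr => n _; rewrite integral_atom2 /lattice_term /lattice.
  by rewrite expr0 invr1 mulr1.
- apply: eq_eseriesr => n _; rewrite integral_atom2 /lattice_term /lattice.
  by rewrite expr0 mulr1.
Qed.

Lemma ramanujan_sum_rec s : -1 < s ->
  ramanujan_sum q c (s + 1) = ((q `^ (s + 1))^-1 - 1) * ramanujan_sum q c s.
Proof.
move=> s1; rewrite /ramanujan_sum.
have -> : q `^ (s + 1 + 1) = q `^ (s + 1) * q.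
  by rewrite powRD ?(gt_eqF q0) ?implybT// powRr1// ltW.
have -> : c `^ (s + 1 + 1) = c `^ (s + 1) * c.
  by rewrite powRD ?(gt_eqF c0) ?implybT// powRr1// ltW.
have : 0 < q `^ (s + 1) < 1 by apply: powR_01; rewrite -?ltrBlDr ?sub0r.
move: (q `^ (s + 1)) => z /andP[z0 z1].
have neg0 a : 0 <= a -> qpoch_inf (- a) q != 0.
  by move=> a0; rewrite qpoch_inf_neq0// (le_lt_trans _ ltr01)// oppr_le0.
rewrite (qpoch_infS q01 (- c * z)) (qpoch_infS q01 z).
rewrite (qpoch_infS q01 (- (q / (c * (z * q))))).
have -> : - (q / (c * (z * q))) * q = - (q / (c * z)).
  by field; rewrite !gt_eqF.
have -> : - c * (z * q) = - c * z * q by ring.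
have h1 : qpoch_inf (- c) q != 0 by rewrite neg0// ltW.
have h2 : qpoch_inf (- (q / c)) q != 0 by rewrite neg0// divr_ge0 ?ltW.
have h3 : qpoch_inf (z * q) q != 0.
  rewrite qpoch_inf_neq0// (lt_trans _ z1)// gtr_pMr//.
  by case/andP: q01.
have h4 : 1 - z != 0 by rewrite gt_eqF// subr_gt0.
by field; rewrite h1 h2 h3 h4 !gt_eqF.
Qed.

Lemma zeta2E n alpha : zeta2 q c n alpha =
  ramanujan_sum q c alpha * (qpoch (q `^ (alpha + 1)) q n / (q ^+ n * qpoch q q n)).
Proof.
rewrite /zeta2 /ramanujan_sum /qpochs_inf !big_cons !big_nil !mulr1.
have -> : q `^ (- alpha) / c = q / (c * q `^ (alpha + 1)).
  rewrite powRN powRD ?(gt_eqF q0) ?implybT// powRr1 ?ltW//; field.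
  by rewrite !gt_eqF ?powR_gt0.
by rewrite !mulNr !invfM; ring.
Qed.

End discrete_moments.

(** * The orthogonality relation *)

Theorem theorem5p1 (R : realType) (q beta : R) (q01 : 0 < q < 1)
    (beta_gt : -1 < beta) (mu : {measure set (measurableTypeR R) -> \bar R})
    (zeta : nat -> R -> R) (mu_zeta : qLaguerre_pair q01 mu zeta)
    (m n s t : nat) :
  let F (z : R[i]) :=
    qLaguerre2 q beta m n z (conjc z) *
    conjc (qLaguerre2 q beta s t z (conjc z)) in
  polar_integrable mu beta F /\
  polar_integral mu beta F =
    (zeta (minn m n) (`|m%:R - n%:R| + beta) *
     ((m == s)%:R * (n == t)%:R))%:C.
Proof.
move=> F.
have -> : `|m%:R - n%:R| + beta = beta + (m - n + (n - m))%:R.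
  rewrite addrC; congr (_ + _); have [mn|/ltnW nm] := leqP m n.
    have /eqP -> : (m - n == 0)%N by rewrite subn_eq0.
    by rewrite add0n distrC -natrB// ger0_norm.
  have /eqP -> : (n - m == 0)%N by rewrite subn_eq0.
  by rewrite addn0 -natrB// ger0_norm.
have alpha_gt : -1 < beta + (m - n + (n - m))%:R by rewrite (lt_le_trans beta_gt)// lerDl.
case: {mu zeta} mu_zeta => [|c c0|c lambda c0 lambda0].
- rewrite (zeta1E q01)//.
  apply: (polar_qLaguerre q01 beta_gt _ (moment1_rec q01)) => e e1.
  exact: (density_momentE q01 (measurable_weight1 q01) (weight1_ge0 q01)
    (weight1_scale q01) (moment1_fin_small q01)).
- rewrite (zeta2E q01 c0).
  apply: (polar_qLaguerre q01 beta_gt (integral_mu2 q01 c0)).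
  exact: ramanujan_sum_rec.
- rewrite zeta3E.
  apply: (polar_qLaguerre (M := moment3 q c lambda) q01 beta_gt) => e e1.
    exact: (density_momentE q01 (measurable_weight3 c q01 lambda0)
      (weight3_ge0 c q01 lambda0) (weight3_scale c q01 lambda0)
      (moment3_fin_small c q01 lambda0)).
  exact: (density_moment_rec q01 (measurable_weight3 c q01 lambda0)
      (weight3_ge0 c q01 lambda0) (weight3_scale c q01 lambda0)
      (moment3_fin_small c q01 lambda0)).
Qed.
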